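(* Let $m,n\ge 2$ be integers, let $G^+_{m,n}$ be the monoid and $G_{m,n}$ the group given by the presentation with generators $s,t_1,\dots,t_m,u_1,\dots,u_n$ and relations $[s,t_1,\dots,t_m]$, $[s,u_1,\dots,u_n]$, $[t_i,u_j]$ ($1\le i\le m$, $1\le j\le n$), and let $\Delta := s\,t_1\cdots t_m\,u_1\cdots u_n\in G^+_{m,n}$. Then for every element $w\in G^+_{m,n}$ the property $(\mathrm{P}(w;\Delta))$ is satisfied: for every $A\in\mathrm{Trans}(w)$ there exists $\delta(A)\in\mathrm{Trans}(w)$ such that $\delta(A)$ left-divides $A$ and $\delta(A)$ left-divides $\Delta$. Consequently the conjugacy problem in the monoid $G^+_{m,n}$ is solvable, and the conjugacy problem in the group $G_{m,n}$ is solvable.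
   Context: The symbol $[x_1,\dots,x_k]$ denotes the cyclic relations $x_1x_2\cdots x_k=x_2\cdots x_kx_1=\cdots=x_kx_1\cdots x_{k-1}$ (all cyclic rotations are equal); in particular $[t_i,u_j]$ means $t_iu_j=u_jt_i$. $G^+_{m,n}$ is the monoid with this presentation (free monoid on the generators modulo the congruence generated by the relations) and $G_{m,n}$ is the group with the same presentation. An element $U$ of a monoid left-divides $V$ if $V=UW$ for some element $W$ of the monoid. For $w$ in a monoid $M$, $\mathrm{Trans}(w)$ is the set of $A\in M$ with $A\neq 1$ such that there exists $Q\in M$ with $AQ=wA$. The conjugacy problem in the monoid is solvable if there is an algorithm that, given two positive words $U,V$ in the generators, decides whether there is an element $A$ of the monoid with $AU=VA$. The conjugacy problem in the group is solvable if there is an algorithm deciding whether two given words in the generators and their inverses represent conjugate elements of the group. *)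

(* Defs.v *)
From HB Require Import structures.
From mathcomp Require Import all_boot boolp.

Set Implicit Arguments.
Unset Strict Implicit.
Unset Printing Implicit Defensive.

Local Open Scope group_scope.
Local Open Scope quotient_scope.

Section PresentedMonoid.
Variables (A : choiceType) (R : seq A -> seq A -> Prop).

(* The congruence on the free monoid [seq A] generated by R. *)
Inductive congruent : seq A -> seq A -> Prop :=
| congruent_refl x : congruent x x
| congruent_sym x y : congruent x y -> congruent y x
| congruent_trans x y z : congruent x y -> congruent y z -> congruent x z
| congruent_rel p l r q : R l r -> congruent (p ++ l ++ q) (p ++ r ++ q).

Lemma congruent_cat x y z t :
  congruent x y -> congruent z t -> congruent (x ++ z) (y ++ t).
Proof.
move=> xy zt; apply: (@congruent_trans _ (y ++ z)).
  elim: xy => {x y} [x|x y _ IH|x y w _ IH1 _ IH2|p l r q Rlr].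
  - exact: congruent_refl.
  - exact: congruent_sym.
  - exact: congruent_trans IH1 IH2.
  - by rewrite -!catA; apply: congruent_rel.
elim: zt => {z t} [z|z t _ IH|z t w _ IH1 _ IH2|p l r q Rlr].
- exact: congruent_refl.
- exact: congruent_sym.
- exact: congruent_trans IH1 IH2.
- by rewrite !(catA y p); apply: congruent_rel.
Qed.

Definition congruentb : rel (seq A) := fun x y => `[< congruent x y >].

Lemma congruentb_refl : reflexive congruentb.
Proof. by move=> x; apply/asboolP; apply: congruent_refl. Qed.

Lemma congruentb_sym : symmetric congruentb.
Proof. by move=> x y; apply/asboolP/asboolP; apply: congruent_sym. Qed.

Lemma congruentb_trans : transitive congruentb.
Proof.
move=> y x z /asboolP xy /asboolP yz; apply/asboolP.
exact: congruent_trans xy yz.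
Qed.

Canonical congruentb_equiv :=
  EquivRel congruentb congruentb_refl congruentb_sym congruentb_trans.

Definition presented_monoid := {eq_quot congruentb}.

HB.instance Definition _ := Choice.on presented_monoid.
HB.instance Definition _ := EqQuotient.on presented_monoid.

Definition class_of (x : seq A) : presented_monoid := \pi_presented_monoid x.

Lemma class_ofP x y : class_of x = class_of y <-> congruent x y.
Proof.
split=> [/eqmodP/asboolP//|xy].
by apply/eqmodP/asboolP.
Qed.

Lemma class_of_surj (a : presented_monoid) : exists x, a = class_of x.
Proof. by exists (repr a); rewrite /class_of reprK. Qed.

Definition pmul (a b : presented_monoid) := class_of (repr a ++ repr b).

Lemma pmulE x y : pmul (class_of x) (class_of y) = class_of (x ++ y).
Proof.
by apply/class_ofP/congruent_cat; apply/class_ofP; rewrite /class_of reprK.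
Qed.

Lemma pmulA : associative pmul.
Proof.
move=> a b c; have [x ->] := class_of_surj a; have [y ->] := class_of_surj b.
by have [z ->] := class_of_surj c; rewrite !pmulE catA.
Qed.

Lemma pmul1g : left_id (class_of [::]) pmul.
Proof. by move=> a; have [x ->] := class_of_surj a; rewrite pmulE. Qed.

Lemma pmulg1 : right_id (class_of [::]) pmul.
Proof. by move=> a; have [x ->] := class_of_surj a; rewrite pmulE cats0. Qed.

HB.instance Definition _ := isMonoid.Build presented_monoid pmulA pmul1g pmulg1.

Lemma class_of1 : class_of [::] = 1.
Proof. by []. Qed.

Lemma class_ofM x y : class_of (x ++ y) = class_of x * class_of y.
Proof. exact/esym/pmulE. Qed.

End PresentedMonoid.

Section PresentedGroup.
Variables (A : choiceType) (R : seq A -> seq A -> Prop).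

(* The group with generators A and relations R, as a monoid on A * bool:
   (a, false) stands for a and (a, true) for its formal inverse. *)
Definition positive_word (x : seq A) : seq (A * bool) :=
  [seq (a, false) | a <- x].

Inductive group_relation : seq (A * bool) -> seq (A * bool) -> Prop :=
| group_relation_rel l r :
    R l r -> group_relation (positive_word l) (positive_word r)
| group_relation_inv a e : group_relation [:: (a, e); (a, ~~ e)] [::].

Definition presented_group := presented_monoid group_relation.

HB.instance Definition _ := Monoid.on presented_group.

Definition inv_word (x : seq (A * bool)) : seq (A * bool) :=
  rev [seq (a.1, ~~ a.2) | a <- x].

Lemma inv_wordK : involutive inv_word.
Proof.
move=> x; rewrite /inv_word map_rev revK -map_comp map_id_in // => -[a e] _ /=.
by rewrite negbK.
Qed.

Lemma congruent_inv_wordr x :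
  congruent group_relation (x ++ inv_word x) [::].
Proof.
elim: x => [|[a e] x IH]; first exact: congruent_refl.
rewrite /inv_word /= rev_cons -cats1 -/(inv_word x).
apply: (@congruent_trans _ _ _ ([:: (a, e)] ++ [::] ++ [:: (a, ~~ e)])).
  rewrite -cat_cons -cat1s -!catA; apply: congruent_cat (congruent_refl _ _) _.
  by rewrite catA; apply: congruent_cat IH (congruent_refl _ _).
exact: (congruent_rel [::] [::] (group_relation_inv a e)).
Qed.

Definition pinv (a : presented_group) : presented_group :=
  class_of group_relation (inv_word (repr a)).

Lemma pmulgV : right_inverse 1 pinv (@mul presented_group).
Proof.
move=> a; rewrite -[a in a * _]reprK -/(class_of _ _) /pinv.
by rewrite -[LHS]class_ofM; apply/class_ofP/congruent_inv_wordr.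
Qed.

Lemma pmulVg : left_inverse 1 pinv (@mul presented_group).
Proof.
move=> a; rewrite -[a in _ * a]reprK -/(class_of _ _) /pinv.
rewrite -[LHS]class_ofM; apply/class_ofP.
by rewrite -[X in _ ++ X]inv_wordK; apply: congruent_inv_wordr.
Qed.

HB.instance Definition _ := hasInv.Build presented_group pinv.
HB.instance Definition _ := Monoid_isGroup.Build presented_group pmulVg pmulgV.

End PresentedGroup.

Section Divisibility.
Variable M : monoidType.

Definition left_divides (U V : M) : Prop := exists W : M, V = U * W.

Definition Trans (w A : M) : Prop := A <> 1 /\ exists Q : M, A * Q = w * A.

Definition property_P (w D : M) : Prop :=
  forall A, Trans w A ->
  exists d, [/\ Trans w d, left_divides d A & left_divides d D].

End Divisibility.

(* Partial recursive functions of k arguments. *)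
Inductive recfun : nat -> Type :=
| rf_zero k : recfun k
| rf_succ : recfun 1
| rf_proj k : 'I_k -> recfun k
| rf_comp k l : recfun l -> ('I_l -> recfun k) -> recfun k
| rf_prec k : recfun k -> recfun k.+2 -> recfun k.+1
| rf_mu k : recfun k.+1 -> recfun k.

(* [computes f v y]: f converges on v, with value y.  In the primitive
   recursion case h lists the successive values; the step function receives
   the counter, the previous value and the parameters, in this order. *)
Fixpoint computes k (f : recfun k) : k.-tuple nat -> nat -> Prop :=
  match f in recfun k return k.-tuple nat -> nat -> Prop with
  | rf_zero _ => fun _ y => y = 0
  | rf_succ => fun v y => y = (thead v).+1
  | rf_proj _ i => fun v y => y = tnth v i
  | rf_comp _ l f g => fun v y =>
      exists2 z : l.-tuple nat,
        forall i, computes (g i) v (tnth z i) & computes f z y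
  | rf_prec _ f g => fun v y =>
      exists h : nat -> nat,
        [/\ computes f [tuple of behead v] (h 0),
            forall i, i < thead v ->
              computes g [tuple of i :: h i :: behead v] (h i.+1)
          & y = h (thead v)]
  | rf_mu _ f => fun v y =>
      computes f [tuple of y :: v] 0 /\
      forall i, i < y -> exists z, computes f [tuple of i :: v] z.+1
  end.

(* The alphabet being finite, its numbering by [enum_rank] is immaterial for
   computability. *)
Definition word_code (A : finType) (x : seq A) : nat :=
  CodeSeq.code [seq val (enum_rank a) | a <- x].

Definition decidable_on_words (A : finType) (P : seq A -> seq A -> Prop) : Prop :=
  exists f : recfun 2, forall x y : seq A,
    (P x y -> computes f [tuple word_code x; word_code y] 1) /\
    (~ P x y -> computes f [tuple word_code x; word_code y] 0).

Definition monoid_conjugacy_solvable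
    (A : finType) (R : seq A -> seq A -> Prop) : Prop :=
  decidable_on_words (fun U V : seq A =>
    exists a : presented_monoid R, a * class_of R U = class_of R V * a).

Definition group_conjugacy_solvable
    (A : finType) (R : seq A -> seq A -> Prop) : Prop :=
  decidable_on_words (fun U V : seq (A * bool) =>
    exists g : presented_group R,
      (class_of (group_relation R) U : presented_group R) ^ g
        = class_of (group_relation R) V).

Section Gmn.
Variables m n : nat.

Definition gen : finType := option ('I_m + 'I_n).
Definition gen_s : gen := None.
Definition gen_t (i : 'I_m) : gen := Some (inl i).
Definition gen_u (j : 'I_n) : gen := Some (inr j).

Definition word_t : seq gen := [seq gen_t i | i <- enum 'I_m].
Definition word_u : seq gen := [seq gen_u j | j <- enum 'I_n].

Inductive cyclic_relation (x : seq gen) : seq gen -> seq gen -> Prop :=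
| CyclicRelation k : cyclic_relation x x (rot k x).

Inductive Gmn_relation : seq gen -> seq gen -> Prop :=
| Gmn_relation_st l r :
    cyclic_relation (gen_s :: word_t) l r -> Gmn_relation l r
| Gmn_relation_su l r :
    cyclic_relation (gen_s :: word_u) l r -> Gmn_relation l r
| Gmn_relation_tu i j l r :
    cyclic_relation [:: gen_t i; gen_u j] l r -> Gmn_relation l r.

Definition Gmn_monoid : monoidType := presented_monoid Gmn_relation.
Definition Gmn_group : groupType := presented_group Gmn_relation.

Definition Delta : Gmn_monoid :=
  class_of Gmn_relation ((gen_s :: word_t) ++ word_u).

End Gmn.

(* Main.v *)
Require Import Defs.
From mathcomp Require Import all_boot boolp.

(** Projecting a word to its letters s, t_i, or to its letters s, u_j, maps the
    monoid to two monoids, each presented by one cyclic relation.  An element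
    is determined by its two projections, and two elements of the cyclic
    monoids come from a common element as soon as they contain s equally often:
    the monoid is the fibre product of the cyclic monoids over the number of
    occurrences of s ([congP], [proj_lift]).

    In the monoid of the cyclic relation of z, the element z is central, and a
    word without a rotation of z as a factor is alone in its class.  Suppose
    that a is such a word and a q = w a.  Let d be the longest prefix of a that
    runs along the cycle.  A rotation of z inside w a cannot straddle the end
    of d, so if there is one then w d contains it, and z and its divisor d
    divide w d.  If there is none, then a q and w a are the same word, with the
    prefixes d and w d; so d divides w d again ([cyclic_property_P]).  Such a d
    divides z, hence contains s at most once.  Out of the two divisors obtained
    from the two projections, one possibly replaced by 1, one can form a pair
    with equally many s, and this pair lifts to the required common divisor
    with Delta ([property_P_Delta]).

    In the group, Delta is central and s = Delta T^-1 U^-1, where T and U are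
    the products of the t_i and of the u_j; so the group is the product of the
    cyclic group of Delta and the free groups on the t_i and on the u_j
    ([word_decomp]), and conjugacy amounts to conjugacy in three free groups
    ([group_conjP]).  Two reduced words are conjugate in a free group exactly
    when they meet after some rounds of moving the first letter to the end and
    reducing; cyclically reduced words come back to themselves, so a bounded
    search decides this ([free_conj_bounded]).  The search is carried out by
    recursive functions on codes: the code of a nonempty word is the pair code
    of its first letter and of the code of its tail, so that lists can be
    processed with the two projections of the pairing ([simulated],
    [sim_foldr]).

    Finally, conjugacy in the monoid is conjugacy in the group: as Delta is
    central and every letter divides it, an equality between fractions holds in
    the monoid after multiplication by a power of Delta, and a conjugator can
    be made positive in the same way ([group_fraction], [monoid_conj_group]). *)

Set Implicit Arguments.
Unset Strict Implicit.
Unset Printing Implicit Defensive.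

(** * Computable functions *)

Definition computable k (f : k.-tuple nat -> nat) : Prop :=
  exists r : recfun k, forall v, computes r v (f v).

Lemma eq_computable k (f g : k.-tuple nat -> nat) :
  f =1 g -> computable f -> computable g.
Proof. by move=> fg [r rf]; exists r => v; rewrite -fg. Qed.

Lemma computable_proj k (i : 'I_k) : computable (fun v => tnth v i).
Proof. by exists (rf_proj i). Qed.

Definition computable_arg1 k := @computable_proj k.+1 ord0.
Definition computable_arg2 k := @computable_proj k.+2 (lift ord0 ord0).
Definition computable_arg3 k := @computable_proj k.+3 (lift ord0 (lift ord0 ord0)).

Lemma computable_comp k l (g : l.-tuple nat -> nat)
    (f : 'I_l -> k.-tuple nat -> nat) :
  computable g -> (forall i, computable (f i)) ->
  computable (fun v => g [tuple f i v | i < l]).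
Proof.
move=> [rg Hg] /fin_all_exists[rf Hf]; exists (rf_comp rg rf) => v /=.
by exists [tuple f i v | i < l] => // i; rewrite tnth_mktuple.
Qed.

Definition computable1 (f : nat -> nat) : Prop :=
  computable (fun v : 1.-tuple nat => f (thead v)).

Definition computable2 (f : nat -> nat -> nat) : Prop :=
  computable (fun v : 2.-tuple nat => f (thead v) (tnth v (lift ord0 ord0))).

Lemma eq_computable1 f g : f =1 g -> computable1 f -> computable1 g.
Proof. by move=> fg; apply: eq_computable => v; rewrite fg. Qed.

Lemma computable_comp1 k g (f : k.-tuple nat -> nat) :
  computable1 g -> computable f -> computable (fun v => g (f v)).
Proof.
move=> Hg Hf; have := computable_comp Hg (fun _ => Hf).
by apply: eq_computable => v; rewrite /thead tnth_mktuple.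
Qed.

Lemma computable_comp2 k g (f1 f2 : k.-tuple nat -> nat) :
  computable2 g -> computable f1 -> computable f2 ->
  computable (fun v => g (f1 v) (f2 v)).
Proof.
move=> Hg Hf1 Hf2.
have Hf : forall i : 'I_2, computable (fun v => if val i is 0 then f1 v else f2 v).
  by case=> -[].
have := computable_comp Hg Hf.
by apply: eq_computable => v; rewrite /thead !tnth_mktuple.
Qed.

Lemma computable1_id : computable1 id.
Proof. exact: computable_proj. Qed.

Lemma computable_succ : computable1 succn.
Proof. by exists rf_succ. Qed.

Lemma computable_const k c : computable (fun _ : k.-tuple nat => c).
Proof.
elim: c => [|c IH]; first by exists (rf_zero k).
exact: computable_comp1 computable_succ IH.
Qed.

Lemma computable_rec (g : nat -> nat -> nat -> nat) (f : nat -> nat) :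
  computable1 f ->
  computable (fun v : 3.-tuple nat =>
    g (thead v) (tnth v (lift ord0 ord0)) (tnth v (lift ord0 (lift ord0 ord0)))) ->
  computable2 (fun n x => nat_rec _ (f x) (fun i r => g i r x) n).
Proof.
move=> [rf Hf] [rg Hg]; exists (rf_prec rf rg) => v /=.
set x := tnth v _; exists (nat_rec _ (f x) (fun i r => g i r x)); split=> //.
  have -> : x = thead [tuple of behead v].
    by rewrite /x /thead tnth_behead; congr tnth; apply: val_inj; rewrite /= inordK.
  exact: Hf.
move=> i _; set w := [tuple of _].
have Ex : tnth w (lift ord0 (lift ord0 ord0)) = x.
  by rewrite /w !tnthS tnth_behead /x; congr tnth; apply: val_inj; rewrite /= inordK.
by have := Hg w; rewrite Ex /w tnthS /thead !tnth0.
Qed.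

Lemma computable2_iter F : computable1 F -> computable2 (fun n x => iter n F x).
Proof.
move=> HF; have := computable_rec (g := fun _ r _ => F r) computable1_id
  (computable_comp1 HF (computable_arg2 _)).
by apply: eq_computable => v /=; elim: (thead v) => //= n ->.
Qed.

Lemma computable_iter k F (n f : k.-tuple nat -> nat) :
  computable1 F -> computable n -> computable f ->
  computable (fun v => iter (n v) F (f v)).
Proof. by move=> /computable2_iter; apply: computable_comp2. Qed.

(** This instance and the next spare the unifier the guess that [f x] stands for
    [f (thead v)]. *)
Lemma computable1_comp2 g (f1 f2 : nat -> nat) :
  computable2 g -> computable1 f1 -> computable1 f2 ->
  computable1 (fun x => g (f1 x) (f2 x)).
Proof. exact: computable_comp2. Qed.

Lemma computable1_comp g f :
  computable1 g -> computable1 f -> computable1 (fun x => g (f x)).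
Proof. exact: computable_comp1. Qed.

Lemma computable_pred : computable1 predn.
Proof.
have := computable_rec (f := fun _ => 0) (g := fun i _ _ => i)
  (computable_const _ 0) (computable_arg1 _).
move/computable1_comp2/(_ computable1_id computable1_id).
by apply: eq_computable1 => -[].
Qed.

Lemma computable_add : computable2 addn.
Proof.
apply: eq_computable (computable_iter computable_succ
  (computable_arg1 _) (computable_arg2 _)) => v.
by rewrite /thead; elim: (tnth v ord0) => //= n ->.
Qed.

Lemma computable_sub : computable2 subn.
Proof.
apply: eq_computable (computable_iter computable_pred
  (computable_arg2 _) (computable_arg1 _)) => v.
by elim: (tnth _ _) => [|n IH]; rewrite ?subn0 //= IH subnS.
Qed.

(** Recursion from [(i + 1)./2 = i - i./2]. *)
Lemma computable_half : computable1 half.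
Proof.
have := computable_rec (f := fun _ => 0) (g := fun i r _ => i - r)
  (computable_const _ 0)
  (computable_comp2 computable_sub (computable_arg1 _) (computable_arg2 _)).
move/computable1_comp2/(_ computable1_id computable1_id).
apply: eq_computable1; elim=> //= n ->.
by rewrite uphalf_half -{1}(odd_double_half n) -addnn addnA addnK.
Qed.

Lemma computable_double : computable1 double.
Proof.
have := computable1_comp2 computable_add computable1_id computable1_id.
by apply: eq_computable1 => n; rewrite addnn.
Qed.

Lemma computable_if k (c a b : k.-tuple nat -> nat) :
  computable c -> computable a -> computable b ->
  computable (fun v => if c v == 0 then a v else b v).
Proof.
move=> Hc Ha Hb.
(* Iterating the constant function 0 is the identity or the zero function. *)
have H0 : computable1 (fun _ => 0) := computable_const 1 0.
have := computable_comp2 computable_add (computable_iter H0 Hc Ha)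
  (computable_iter H0 (computable_comp2 computable_sub (computable_const _ 1) Hc) Hb).
by apply: eq_computable => v; case: (c v) => [|[|n]] //=; rewrite addn0.
Qed.

(** The step of [CodeSeq.code], so that the code of a list is the pair code of
    its head and of the code of its tail. *)
Definition code_pair (a b : nat) : nat := 2 ^ a * b.*2.+1.

Lemma computable_code_pair : computable2 code_pair.
Proof.
have := computable_iter computable_double (computable_arg1 1)
  (computable_comp1 computable_succ
    (computable_comp1 computable_double (computable_arg2 0))).
apply: eq_computable => v; rewrite /code_pair /thead.
by elim: (tnth v ord0) => [|n IH] /=; rewrite ?mul1n // IH expnS -mulnA mul2n.
Qed.

(** The parity test is spelled with subtraction and halving to be visibly
    computable.  Iterating from [code_pair a b] divides out the power of 2 and
    then stays at the odd part. *)
Definition halve_even (x : nat) : nat := if x - x./2.*2 == 0 then x./2 else x.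

Lemma halve_evenE x : halve_even x = if odd x then x else x./2.
Proof.
by rewrite /halve_even -{1}(odd_double_half x) addnK; case: (odd x).
Qed.

Definition evenb x := 1 - (x - x./2.*2).

Lemma evenbE x : evenb x = ~~ odd x.
Proof. by rewrite /evenb -{1}(odd_double_half x) addnK; case: (odd x). Qed.

Lemma computable_parity : computable1 (fun x => x - x./2.*2).
Proof.
apply: (computable1_comp2 computable_sub computable1_id).
exact: computable1_comp computable_double computable_half.
Qed.

Lemma computable_halve_even : computable1 halve_even.
Proof.
exact: computable_if computable_parity computable_half computable1_id.
Qed.

Lemma computable_evenb : computable1 evenb.
Proof.
exact: (computable1_comp2 (f1 := fun _ => 1) computable_sub
  (computable_const _ _) computable_parity).
Qed.

Definition code_snd (x : nat) : nat := (iter x halve_even x)./2.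

(** Counts the even values met while halving; [x] rounds suffice since
    [a < code_pair a b]. *)
Definition code_fst (x : nat) : nat :=
  nat_rec _ 0 (fun i r => r + evenb (iter i halve_even x)) x.

Lemma computable_code_snd : computable1 code_snd.
Proof.
exact: (computable1_comp computable_half
  (computable_iter computable_halve_even computable1_id computable1_id)).
Qed.

Lemma computable_code_fst : computable1 code_fst.
Proof.
have := computable_rec (f := fun _ => 0)
  (g := fun i r x => r + evenb (iter i halve_even x))
  (computable_const _ 0) (computable_comp2 computable_add (computable_arg2 _)
  (computable_comp1 computable_evenb (computable_iter computable_halve_even
    (computable_arg1 _) (computable_arg3 _)))).
by move/computable1_comp2/(_ computable1_id computable1_id).
Qed.

Lemma iter_halve_even a b i :
  iter i halve_even (code_pair a b) = code_pair (a - i) b.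
Proof.
elim: i => [|i IH]; rewrite ?subn0 //= IH subnS halve_evenE /code_pair.
case: (a - i) => [|k]; first by rewrite mul1n oddS odd_double.
by rewrite expnS -mulnA mul2n odd_double doubleK.
Qed.

Lemma ltn_code_pair a b : a < code_pair a b.
Proof. by rewrite /code_pair (leq_trans (ltn_expl a (ltnSn 1))) // leq_pmulr. Qed.

Lemma code_sndK a b : code_snd (code_pair a b) = b.
Proof.
rewrite /code_snd iter_halve_even.
have /ltnW := ltn_code_pair a b; rewrite -subn_eq0 => /eqP->.
by rewrite /code_pair mul1n /= uphalf_double.
Qed.

Lemma code_fstK a b : code_fst (code_pair a b) = a.
Proof.
have H n : nat_rec (fun _ => nat) 0
    (fun i r => r + evenb (iter i halve_even (code_pair a b))) n = minn n a.
  elim: n => [|n IH]; rewrite ?min0n //= IH iter_halve_even evenbE.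
  rewrite /code_pair; case: (ltnP n a) => [lt|ge].
    rewrite -(subnSK lt) expnS -mulnA mul2n odd_double addn1.
    by rewrite (minn_idPl lt).
  move: (ge); rewrite -subn_eq0 => /eqP->; rewrite mul1n oddS odd_double addn0.
  by rewrite (minn_idPr (leqW ge)).
by rewrite /code_fst H; apply/minn_idPr/ltnW/ltn_code_pair.
Qed.

(** * Computable functions on coded data *)

(** Nothing is required of the recursive function outside the image of the
    coding [cX]; functions on finite types and on words over them can thus be
    treated without decoding. *)
Definition simulated X Y (cX : X -> nat) (cY : Y -> nat) (f : X -> Y) : Prop :=
  exists2 F, computable1 F & forall x, F (cX x) = cY (f x).

Definition pair_code X Y (cX : X -> nat) (cY : Y -> nat) (p : X * Y) : nat :=
  code_pair (cX p.1) (cY p.2).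

Definition letter_code (A : finType) (a : A) : nat := enum_rank a.

Section Simulation.
Variables (X Y Z : Type) (cX : X -> nat) (cY : Y -> nat) (cZ : Z -> nat).

Lemma eq_simulated (f g : X -> Y) :
  f =1 g -> simulated cX cY f -> simulated cX cY g.
Proof. by move=> fg [F HF Ff]; exists F => // x; rewrite Ff fg. Qed.

Lemma sim_id : simulated cX cX id.
Proof. by exists id => //; apply: computable1_id. Qed.

Lemma sim_const (y : Y) : simulated cX cY (fun _ => y).
Proof. by exists (fun _ => cY y) => //; apply: computable_const. Qed.

Lemma sim_comp (g : Y -> Z) (f : X -> Y) :
  simulated cY cZ g -> simulated cX cY f -> simulated cX cZ (fun x => g (f x)).
Proof.
move=> [G HG Gg] [F HF Ff]; exists (fun x => G (F x)); last by move=> x; rewrite Ff Gg.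
exact: computable1_comp.
Qed.

Lemma sim_pair (f : X -> Y) (g : X -> Z) :
  simulated cX cY f -> simulated cX cZ g ->
  simulated cX (pair_code cY cZ) (fun x => (f x, g x)).
Proof.
move=> [F HF Ff] [G HG Gg]; exists (fun x => code_pair (F x) (G x)).
  exact: (computable1_comp2 computable_code_pair).
by move=> x; rewrite Ff Gg.
Qed.

Lemma sim_fst : simulated (pair_code cX cY) cX fst.
Proof.
by exists code_fst => [|x]; [apply: computable_code_fst | apply: code_fstK].
Qed.

Lemma sim_snd : simulated (pair_code cX cY) cY snd.
Proof.
by exists code_snd => [|x]; [apply: computable_code_snd | apply: code_sndK].
Qed.

Lemma sim_if (b : X -> bool) (f g : X -> Y) :
  simulated cX nat_of_bool b -> simulated cX cY f -> simulated cX cY g ->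
  simulated cX cY (fun x => if b x then f x else g x).
Proof.
move=> [B HB Bb] [F HF Ff] [G HG Gg]; exists (fun x => if B x == 0 then G x else F x).
  exact: computable_if.
by move=> x; rewrite Bb Ff Gg; case: (b x).
Qed.

Lemma sim_iter (F : Y -> Y) (n : X -> nat) (f : X -> Y) :
  simulated cY cY F -> simulated cX id n -> simulated cX cY f ->
  simulated cX cY (fun x => iter (n x) F (f x)).
Proof.
move=> [F' HF FF] [n' Hn nn] [f' Hf ff]; exists (fun x => iter (n' x) F' (f' x)).
  exact: (computable_iter HF Hn Hf).
by move=> x; rewrite nn ff; elim: (n x) => //= k ->.
Qed.

(** Codes bound sizes, hence serve as numbers of rounds for [sim_iter]. *)
Lemma sim_code (f : X -> Y) :
  simulated cX cY f -> simulated cX id (fun x => cY (f x)).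
Proof. by case=> F HF Ff; exists F. Qed.

Lemma sim_addn (f g : X -> nat) :
  simulated cX id f -> simulated cX id g -> simulated cX id (fun x => f x + g x).
Proof.
move=> [F HF Ff] [G HG Gg]; exists (fun x => F x + G x).
  exact: (computable1_comp2 computable_add).
by move=> x; rewrite Ff Gg.
Qed.

Lemma computable_neq : computable2 (fun a b => (a - b) + (b - a)).
Proof.
exact: computable_comp2 computable_add
  (computable_comp2 computable_sub (computable_arg1 _) (computable_arg2 _))
  (computable_comp2 computable_sub (computable_arg2 _) (computable_arg1 _)).
Qed.

(** This makes all functions on a finite alphabet computable. *)
Lemma computable_table (c : nat -> nat) (K : nat) :
  exists2 F, computable1 F & forall i, i < K -> F i = c i.
Proof.
elim: K => [|K [F HF Fc]]; first by exists id => //; apply: computable1_id.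
exists (fun x => if (x - K) + (K - x) == 0 then c K else F x).
  apply: computable_if (computable_const _ _) HF.
  exact: (computable1_comp2 (f2 := fun _ => K) computable_neq computable1_id
    (computable_const _ _)).
move=> i; rewrite ltnS addn_eq0 !subn_eq0 -eqn_leq leq_eqVlt.
by case: eqP => [-> // | _ /Fc].
Qed.

End Simulation.

Section SimulationEq.
Variables (X : Type) (cX : X -> nat) (T : eqType) (cT : T -> nat).

Lemma sim_eq (f g : X -> T) :
  injective cT -> simulated cX cT f -> simulated cX cT g ->
  simulated cX nat_of_bool (fun x => f x == g x).
Proof.
move=> injT [F HF Ff] [G HG Gg].
exists (fun x => if (F x - G x) + (G x - F x) == 0 then 1 else 0).
  apply: computable_if (computable_const _ _) (computable_const _ _).
  exact: (computable1_comp2 computable_neq HF HG).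
by move=> x; rewrite Ff Gg addn_eq0 !subn_eq0 -eqn_leq inj_eq.
Qed.

Lemma sim_fin (A : finType) (Y : Type) (cY : Y -> nat) (f : A -> Y) :
  simulated (@letter_code A) cY f.
Proof.
case: (pickP A) => [a0 _ | A0]; last first.
  by exists id; [apply: computable1_id | move=> a; have := A0 a].
have [F HF Fc] := computable_table (fun i => cY (f (nth a0 (enum A) i))) #|A|.
exists F => // a; rewrite Fc ?ltn_ord //.
by rewrite -enum_val_nth enum_rankK.
Qed.

End SimulationEq.

Section SimulationWords.
Variable A : finType.
Notation cA := (@letter_code A).
Notation cW := (@word_code A).

Lemma letter_code_inj : injective cA.
Proof. by move=> a b /ord_inj/enum_rank_inj. Qed.

Lemma word_code_inj : injective cW.
Proof.
move=> x y /(can_inj CodeSeq.codeK) /inj_map; apply => a b.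
exact: letter_code_inj.
Qed.

Lemma word_code_cons a x : cW (a :: x) = code_pair (cA a) (cW x).
Proof. by []. Qed.

Lemma word_code_gt0 a x : (cW (a :: x) == 0) = false.
Proof. by rewrite word_code_cons /code_pair muln_eq0 expn_eq0. Qed.

Lemma size_word_code x : size x <= cW x.
Proof.
elim: x => //= a x IH; rewrite word_code_cons /code_pair -[(size x).+1]mul1n.
by rewrite leq_mul ?expn_gt0 // ltnS (leq_trans IH) // -addnn leq_addr.
Qed.

Lemma sim_cons : simulated (pair_code cA cW) cW (fun p => p.1 :: p.2).
Proof. by exists id => [|x] //; apply: computable1_id. Qed.

Lemma sim_behead : simulated cW cW behead.
Proof.
exists code_snd => [|[|a x]] //; first exact: computable_code_snd.
by rewrite word_code_cons code_sndK.
Qed.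

Lemma sim_head : simulated (pair_code cA cW) cA (fun p => head p.1 p.2).
Proof.
exists (fun n => if code_snd n == 0 then code_fst n else code_fst (code_snd n)).
  apply: (computable_if computable_code_snd computable_code_fst).
  exact: computable1_comp computable_code_fst computable_code_snd.
move=> [a [|b x]]; rewrite /pair_code code_sndK /= ?code_fstK //.
by rewrite word_code_gt0.
Qed.

Lemma sim_head_word : simulated cW cW (fun x => if x is a :: _ then [:: a] else [::]).
Proof.
exists (fun n => if n == 0 then 0 else code_pair (code_fst n) 0).
  apply: (computable_if computable1_id (computable_const _ _)).
  exact: (computable1_comp2 (f2 := fun _ => 0) computable_code_pair
    computable_code_fst (computable_const _ _)).
by move=> [|a x] //; rewrite word_code_gt0 word_code_cons code_fstK.
Qed.

Section Folds.
Variables (X : Type) (cX : X -> nat) (f : A -> X -> X).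
Hypothesis sim_f : simulated (pair_code cA cX) cX (fun p => f p.1 p.2).

(** One round of a left fold on the pair of the remaining list and the
    accumulator; more rounds than letters are harmless. *)
Definition foldl_step (p : seq A * X) : seq A * X :=
  if p.1 is a :: s then (s, f a p.2) else p.

Lemma iter_foldl_step s x n :
  size s <= n -> iter n foldl_step (s, x) = ([::], foldl (fun y a => f a y) x s).
Proof.
by elim: n s x => [|n IH] [|a s] x // le_sn; rewrite iterSr; apply: IH.
Qed.

Lemma sim_foldl :
  simulated (pair_code cW cX) cX (fun p => foldl (fun y a => f a y) p.2 p.1).
Proof.
have [F HF Ff] := sim_f.
have Hstep : simulated (pair_code cW cX) (pair_code cW cX) foldl_step.
  exists (fun p => if code_fst p == 0 then p else
    code_pair (code_snd (code_fst p))
      (F (code_pair (code_fst (code_fst p)) (code_snd p)))).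
    have HT := computable1_comp computable_code_snd computable_code_fst.
    have HH := computable1_comp computable_code_fst computable_code_fst.
    have HF' := computable1_comp HF
      (computable1_comp2 computable_code_pair HH computable_code_snd).
    exact: (computable_if computable_code_fst computable1_id
      (computable1_comp2 computable_code_pair HT HF')).
  move=> [[|a s] x]; rewrite /pair_code /= !code_fstK //.
  rewrite word_code_gt0 word_code_cons !code_sndK; congr code_pair; exact: Ff (a, x).
have := sim_comp (sim_snd cW cX)
  (sim_iter Hstep (sim_code (sim_fst cW cX)) (sim_id (pair_code cW cX))).
apply: eq_simulated => -[s x] /=.
by rewrite iter_foldl_step // size_word_code.
Qed.

End Folds.

(** Right folds are left folds of the reversed word. *)
Lemma sim_rev : simulated cW cW rev.
Proof.
have := sim_comp (sim_foldl sim_cons) (sim_pair (sim_id cW) (sim_const cW cW [::])).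
apply: eq_simulated => s /=.
suff H t : foldl (fun y a => a :: y) t s = rev s ++ t by rewrite H cats0.
by elim: s t => //= a s IH t; rewrite IH rev_cons cat_rcons.
Qed.

Lemma sim_foldr (X : Type) (cX : X -> nat) (f : A -> X -> X) :
  simulated (pair_code cA cX) cX (fun p => f p.1 p.2) ->
  simulated (pair_code cW cX) cX (fun p => foldr f p.2 p.1).
Proof.
move=> /sim_foldl sim_f; have := sim_comp sim_f
  (sim_pair (sim_comp sim_rev (sim_fst cW cX)) (sim_snd cW cX)).
by apply: eq_simulated => -[s x] /=; rewrite foldl_rev.
Qed.

End SimulationWords.

Lemma decidable_simulated (A : finType) (P : seq A -> seq A -> Prop)
    (b : seq A * seq A -> bool) :
  simulated (pair_code (@word_code A) (@word_code A)) nat_of_bool b ->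
  (forall x y, P x y <-> b (x, y)) -> decidable_on_words P.
Proof.
move=> [F HF Fb] Pb.
have [r Hr] := computable_comp1 HF computable_code_pair.
exists r => x y; have := Hr [tuple word_code x; word_code y].
rewrite (_ : tnth _ _ = word_code y) // (_ : thead _ = word_code x) //.
by rewrite (Fb (x, y)) Pb; case: (b _) => Hxy; split.
Qed.

Lemma sim_andb (X : Type) (cX : X -> nat) (b1 b2 : X -> bool) :
  simulated cX nat_of_bool b1 -> simulated cX nat_of_bool b2 ->
  simulated cX nat_of_bool (fun p => b1 p && b2 p).
Proof.
move=> H1 H2; have := sim_if H1 H2 (sim_const _ _ false).
by apply: eq_simulated => p; case: (b1 p).
Qed.

(** * Free groups *)

Section FreeGroup.
Variable A : choiceType.
Implicit Types (a b : A * bool) (w x y z st : seq (A * bool)).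

Definition flip a := (a.1, ~~ a.2).

Lemma flipK : involutive flip.
Proof. by case=> a e; rewrite /flip negbK. Qed.

Lemma flip_neq a : (a == flip a) = false.
Proof. by case: a => a []; rewrite /flip xpair_eqE andbF. Qed.

Lemma inv_word_cat x y : inv_word (x ++ y) = inv_word y ++ inv_word x.
Proof. by rewrite /inv_word map_cat rev_cat. Qed.

Lemma inv_word_cons a x : inv_word (a :: x) = rcons (inv_word x) (flip a).
Proof. by rewrite /inv_word /= rev_cons. Qed.

(** Left multiplication of a reduced word by a letter.  The default [a] of
    [head] differs from [flip a], so nothing is removed from the empty word. *)
Definition push a st := if head a st == flip a then behead st else a :: st.

(** The free group in its action on reduced words: reduced words serve as
    group elements, and [freduce w] as the element represented by [w]. *)
Definition act w st := foldr push st w.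

Definition freduce w := act w [::].

Definition reduced := sorted (fun a b => b != flip a).

Lemma act_cat x y st : act (x ++ y) st = act x (act y st).
Proof. exact: foldr_cat. Qed.

Lemma reduced_behead x : reduced x -> reduced (behead x).
Proof. by case: x => //= a x /path_sorted. Qed.

Lemma reduced_push a st : reduced st -> reduced (push a st).
Proof.
rewrite /push; case: ifP => [_ /reduced_behead // | neq].
by case: st neq => //= b st ->.
Qed.

Lemma reduced_act w st : reduced st -> reduced (act w st).
Proof. by elim: w => //= a w IH /IH; apply: reduced_push. Qed.

Lemma reduced_freduce w : reduced (freduce w).
Proof. exact: reduced_act. Qed.

(** A letter and its inverse act by inverse bijections of the reduced words. *)
Lemma pushK a st : reduced st -> push (flip a) (push a st) = st.
Proof.
case: st => [|b st] /= red_st; first by rewrite /push /= flip_neq /= flipK eqxx.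
rewrite {2}/push /=; case: eqP red_st => [->|neq] red_st; last first.
  by rewrite /push /= flipK eqxx.
case: st red_st => [|c st] /=.
  by rewrite /push /= flip_neq.
by rewrite /push /= flipK; case/andP => /negPf->.
Qed.

Lemma act_invl w st : reduced st -> act (inv_word w) (act w st) = st.
Proof.
elim: w => //= a w IH red_st.
by rewrite inv_word_cons -cats1 act_cat /= pushK ?IH // reduced_act.
Qed.

Lemma act_invr w st : reduced st -> act w (act (inv_word w) st) = st.
Proof. by move=> red_st; rewrite -{1}[w]inv_wordK act_invl. Qed.

Lemma act_freduce w st : reduced st -> act w st = act (freduce w) st.
Proof.
move=> red_st; elim: w => //= a w ->; rewrite /freduce /= -/(freduce w).
rewrite {2}/push; case: eqP => //.
case: (freduce w) => [|b y] /=; first by move/eqP; rewrite flip_neq.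
by move=> ->; rewrite -{1}[a]flipK pushK // reduced_act.
Qed.

Lemma act_reduced w st : reduced (w ++ st) -> act w st = w ++ st.
Proof.
elim: w => //= a w IH red; rewrite IH; last exact: path_sorted red.
rewrite /push; case: (w ++ st) red => [|b y] /=; first by rewrite flip_neq.
by case/andP => /negPf->.
Qed.

(** Conjugation of a reduced word by its first letter, with reduction. *)
Definition conj_head x := if x is a :: y then act y [:: a] else [::].

(** Conjugacy in the free group, stated through the orbits of [conj_head].
    Being in merging orbits of a function is clearly transitive. *)
Definition free_conj x y :=
  exists i j, iter i conj_head (freduce x) = iter j conj_head (freduce y).

Lemma free_conj_refl x : free_conj x x.
Proof. by exists 0, 0. Qed.

Lemma free_conj_trans x y z : free_conj x y -> free_conj y z -> free_conj x z.
Proof.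
move=> [i [j Exy]] [k [l Eyz]]; exists (k + i), (j + l).
by rewrite !iterD Exy -Eyz -!iterD addnC.
Qed.

Lemma eq_free_conj x y : freduce x = freduce y -> free_conj x y.
Proof. by exists 0, 0. Qed.

(** The reduced forms of [x] and of [b^-1 x b] are equal, or one of them is the
    image of the other under [conj_head]. *)
Lemma free_conj_letter b x : free_conj (flip b :: rcons x b) x.
Proof.
have: freduce (flip b :: rcons x b) = push (flip b) (act (freduce x) [:: b]).
  have Eb : act [:: b] [::] = [:: b] by rewrite /= /push /= flip_neq.
  by rewrite /freduce /= -cats1 act_cat Eb act_freduce.
rewrite /free_conj => ->; have := reduced_freduce x.
case: (lastP (freduce x)) => [|y c] red_y.
  by exists 0, 0; rewrite /= /push /= flipK eqxx.
case: (boolP (b == flip c)) red_y => [/eqP->|neq] red_y.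
  (* The last letter of [x] cancels against [b]. *)
  have red_y' : reduced y by move: red_y; rewrite /reduced -cats1 => /cat_sorted2[].
  have -> : act (rcons y c) [:: flip c] = y.
    by rewrite -cats1 act_cat /= {1}/push /= eqxx /= act_reduced cats0.
  rewrite flipK; case: y red_y red_y' => [|d y] red_y red_y'.
    by exists 0, 0; rewrite /= /push /= flip_neq.
  rewrite /push; case: eqP => [/= Ed|_].
    exists 0, 1; rewrite /= -cats1 act_cat /= {1}/push /= Ed eqxx /=.
    by rewrite act_reduced ?cats0 //; move: red_y' => /path_sorted.
  by exists 1, 0; apply: etrans (act_reduced _) _; rewrite cats1.
have red_yb : reduced (rcons y c ++ [:: b]).
  rewrite cats1 /reduced; case: y red_y => [|d y] /=; first by rewrite neq.
  by move=> red_y; rewrite rcons_path last_rcons red_y neq.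
rewrite act_reduced //; case E: (rcons y c) red_y red_yb => [|d z] red_y red_yb.
  by move/(congr1 size): E; rewrite size_rcons.
rewrite {1}/push /= flipK; case: eqP => [->|_].
  by exists 0, 1; rewrite /= act_reduced //; move: red_yb => /path_sorted.
exists 1, 0; apply: etrans (act_cat (d :: z) [:: b] [:: flip b]) _.
have -> : act [:: b] [:: flip b] = [::] by rewrite /= /push /= eqxx.
by rewrite act_reduced ?cats0.
Qed.

Lemma free_conj_conj x y : free_conj (inv_word y ++ x ++ y) x.
Proof.
elim/last_ind: y => [|y b IH]; first by rewrite /inv_word cats0; apply: free_conj_refl.
rewrite -{1}cats1 inv_word_cat -!rcons_cat.
exact: free_conj_trans (free_conj_letter b _) IH.
Qed.

(** On cyclically reduced words [conj_head] is a rotation; on other reduced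
    words it shortens. *)
Definition cyc_reduced := cycle (fun a b => b != flip a).

Lemma conj_head_cyc x : cyc_reduced x -> conj_head x = rot 1 x.
Proof.
case: x => // a x cx; rewrite rot1_cons -cats1 [LHS]act_reduced // cats1.
exact: path_sorted cx.
Qed.

Lemma iter_conj_head_cyc i x : cyc_reduced x -> iter i conj_head x = iter i (rot 1) x.
Proof.
move=> cx; elim: i => //= i ->; apply: conj_head_cyc.
by elim: i => //= i IH; rewrite /cyc_reduced rot_cycle.
Qed.

Lemma cyc_reduced_conj_head x : cyc_reduced x -> cyc_reduced (conj_head x).
Proof. by move=> cx; rewrite conj_head_cyc // /cyc_reduced rot_cycle. Qed.

Lemma reduced_conj_head x : reduced x -> reduced (conj_head x).
Proof. by case: x => // a x _; apply: reduced_act. Qed.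

Lemma size_conj_head x : reduced x -> ~~ cyc_reduced x -> size (conj_head x) < size x.
Proof.
case: x => //= a x red_x; rewrite rcons_path red_x /= negbK.
case: (lastP x) red_x => [|y b] red_x /=; first by rewrite flip_neq.
rewrite last_rcons => /eqP->; rewrite -cats1 act_cat /= {1}/push /= eqxx /=.
move: red_x => /path_sorted; rewrite -cats1 => /cat_sorted2[red_y _].
by rewrite act_reduced ?cats0 // size_cat /= addn1 ltnS.
Qed.

Lemma cyc_reduced_iter n x :
  reduced x -> size x <= n -> cyc_reduced (iter n conj_head x).
Proof.
elim: n x => [|n IH] x red_x; first by case: x red_x.
rewrite iterSr => sx; case: (boolP (cyc_reduced x)) => cx.
  move/cyc_reduced_conj_head: cx.
  by elim: n {IH sx} (conj_head x) => //= n IH y /IH/cyc_reduced_conj_head.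
apply: IH; first exact: reduced_conj_head.
exact: leq_trans (size_conj_head red_x cx) sx.
Qed.

Lemma size_iter_conj_head n x : reduced x -> size (iter n conj_head x) <= size x.
Proof.
elim: n x => // n IH x red_x; rewrite iterSr.
apply: leq_trans (IH _ (reduced_conj_head red_x)) _.
case: (boolP (cyc_reduced x)) => [cx|/(size_conj_head red_x)/ltnW //].
by rewrite conj_head_cyc ?size_rot.
Qed.

Lemma iter_rot1_size x k : iter (k * size x) (rot 1) x = x.
Proof.
have H i : i <= size x -> iter i (rot 1) x = rot i x.
  elim: i => [|i IH] lt_i; first by rewrite rot0.
  by rewrite iterS (IH (ltnW lt_i)) -rotS.
elim: k => // k IH; rewrite mulSn addnC iterD H //.
by rewrite rot_size.
Qed.

(** After [N] rounds both words are cyclically reduced, and from then on the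
    orbits are periodic with period the length; so meeting orbits coincide, and
    one word reaches the other within one period. *)
Lemma free_conj_bounded N x y :
  size (freduce x) <= N -> size (freduce y) <= N ->
  (exists2 i, i <= N &
     iter i conj_head (iter N conj_head (freduce x)) = iter N conj_head (freduce y))
  <-> free_conj x y.
Proof.
set X := freduce x; set Y := freduce y => sX sY.
have cX := cyc_reduced_iter (reduced_freduce x) sX.
have cY := cyc_reduced_iter (reduced_freduce y) sY.
split=> [[i _ E]|[i [j E]]]; first by exists (i + N), N; rewrite iterD.
have {E} : iter i conj_head (iter N conj_head X) = iter j conj_head (iter N conj_head Y).
  by rewrite -!iterD (addnC i) (addnC j) !iterD E.
have : size (iter N conj_head X) <= N.
  exact: leq_trans (size_iter_conj_head _ (reduced_freduce x)) sX.
rewrite -/X -/Y in cX cY *.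
move: (iter N conj_head X) (iter N conj_head Y) cX cY => X0 Y0 cX cY sX0.
rewrite iter_conj_head_cyc // (iter_conj_head_cyc j) // => E.
have szE : size X0 = size Y0.
  have H k z : size (iter k (rot 1) z) = size z by elim: k => //= k; rewrite size_rot.
  by rewrite -(H i X0) E H.
case: (posnP (size Y0)) => [sY0|sY0].
  exists 0 => //=; apply/eqP; move: szE; rewrite sY0.
  by case: (Y0) sY0 => // _; case: (X0).
have {}E : iter (j * size Y0 - j + i) (rot 1) X0 = Y0.
  by rewrite iterD E -iterD subnK ?iter_rot1_size // leq_pmulr.
set k := _ + _ in E; exists (k %% size X0).
  by rewrite ltnW // (leq_trans _ sX0) // ltn_pmod // szE.
rewrite iter_conj_head_cyc // -{}E {2}(divn_eq k (size X0)) addnC iterD.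
by rewrite iter_rot1_size.
Qed.

End FreeGroup.

(** * Decidability of conjugacy in free groups *)

Section FreeConj.
Variable A : finType.
Let L : finType := (A * bool)%type.
Notation cL := (@letter_code L).
Notation cW := (@word_code L).

Lemma sim_push : simulated (pair_code cL cW) cW (fun p => push p.1 p.2).
Proof.
have sL := sim_fst cL cW; have sW := sim_snd cL cW.
apply: sim_if (sim_comp (@sim_behead _) sW) (@sim_cons L).
apply: sim_eq (@letter_code_inj _) (@sim_head _) _.
exact: sim_comp (sim_fin _ (@flip A)) sL.
Qed.

Lemma sim_act : simulated (pair_code cW cW) cW (fun p => act p.1 p.2).
Proof. exact: sim_foldr sim_push. Qed.

Lemma sim_conj_head : simulated cW cW (@conj_head A).
Proof.
have := sim_comp sim_act (sim_pair (@sim_behead L) (@sim_head_word L)).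
by apply: eq_simulated => -[].
Qed.

(** Follows the orbit of the first component until it hits the second. *)
Definition chase (p : seq L * seq L) := if p.1 == p.2 then p else (conj_head p.1, p.2).

Lemma chaseP n x y :
  reflect (exists2 i, i <= n & iter i (@conj_head A) x = y)
    ((iter n chase (x, y)).1 == y).
Proof.
have snd_chase k z : (iter k chase (z, y)).2 = y.
  by elim: k => //= k IH; rewrite /chase; case: ifP.
elim: n x => [|n IH] x /=.
  by apply: (iffP eqP) => [->|[[|i] //= _ <-]] //; exists 0.
rewrite -iterS iterSr {2}/chase /=; case: (x =P y) => [<-|neq].
  have -> : iter n chase (x, x) = (x, x).
    by elim: n {IH} => //= n ->; rewrite /chase eqxx.
  by rewrite eqxx; constructor; exists 0.
apply: (iffP (IH _)) => [[i le <-]|[[|i] le E]]; first by exists i.+1; rewrite // iterSr.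
  by case: neq.
by exists i; rewrite // -iterSr.
Qed.

Definition free_conjb (x y : seq L) : bool :=
  let X := freduce x in let Y := freduce y in
  let n := word_code X + word_code Y in
  let X' := iter n (@conj_head A) X in let Y' := iter n (@conj_head A) Y in
  (iter n chase (X', Y')).1 == Y'.

Lemma free_conjP x y : free_conj x y <-> free_conjb x y.
Proof.
rewrite /free_conjb; set n := _ + _; rewrite -(free_conj_bounded (N := n)).
- by split=> /chaseP.
- exact: leq_trans (size_word_code _) (leq_addr _ _).
- exact: leq_trans (size_word_code _) (leq_addl _ _).
Qed.

Section Hom.
Variables (B : finType) (h : B -> seq L).
Notation cB := (@word_code B).

Lemma freduce_flatten x :
  freduce (flatten (map h x)) = foldr (fun a st => act (h a) st) [::] x.
Proof. by rewrite /freduce; elim: x => //= a x <-; rewrite act_cat. Qed.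

Lemma sim_freduce : simulated cB cW (fun x => freduce (flatten (map h x))).
Proof.
have cl := sim_fst (@letter_code B) cW.
have step : simulated (pair_code (@letter_code B) cW) cW (fun p => act (h p.1) p.2).
  exact: (sim_comp sim_act (sim_pair (sim_comp (sim_fin _ h) cl) (sim_snd _ _))).
have := sim_comp (sim_foldr (f := fun a st => act (h a) st) step)
  (sim_pair (sim_id cB) (sim_const cB cW [::])).
by apply: eq_simulated => x; rewrite freduce_flatten.
Qed.

Lemma sim_free_conjb :
  simulated (pair_code cB cB) nat_of_bool
    (fun p => free_conjb (flatten (map h p.1)) (flatten (map h p.2))).
Proof.
have sX := sim_comp sim_freduce (sim_fst cB cB).
have sY := sim_comp sim_freduce (sim_snd cB cB).
have sn := sim_addn (sim_code sX) (sim_code sY).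
have sX' := sim_iter sim_conj_head sn sX; have sY' := sim_iter sim_conj_head sn sY.
apply: (sim_eq (@word_code_inj _) _ sY').
have schase : simulated (pair_code cW cW) (pair_code cW cW) chase.
  have s1 := sim_fst cW cW; have s2 := sim_snd cW cW.
  exact: sim_if (sim_eq (@word_code_inj _) s1 s2) (sim_id _)
    (sim_pair (sim_comp sim_conj_head s1) s2).
exact: (sim_comp (sim_fst cW cW) (sim_iter schase sn (sim_pair sX' sY'))).
Qed.

End Hom.
End FreeConj.

(** * The monoid as a fibre product of two cyclic monoids *)

Section Words.
Variable T : eqType.
Implicit Types (p q a b f : seq T).

Lemma cat_eq_split a b p q :
  a ++ b = p ++ q ->
  (exists s, p = a ++ s /\ b = s ++ q) \/ (exists s, a = p ++ s /\ q = s ++ b).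
Proof.
elim: a p => [|x a IH] [|y p] /=.
- by move=> ->; left; exists [::].
- by move=> ->; left; exists (y :: p).
- by move=> <-; right; exists (x :: a).
case=> -> /IH[[s [-> ->]]|[s [-> ->]]]; [left|right]; by exists s.
Qed.

(** An [e]-sorted factor cannot straddle a place where [e] fails. *)
Lemma infix_break (e : rel T) f a x y b :
  sorted e f -> ~~ e x y -> infix f (rcons a x ++ y :: b) ->
  infix f (rcons a x) || infix f (y :: b).
Proof.
move=> sf exy /infixP[p [q /cat_eq_split[[s [_ ->]]|[s [Ea]]]]].
  by rewrite (infix_catl s (infix_catr q (infix_refl f))) orbT.
move/esym=> /cat_eq_split[[s' [Ef Eb]]|[s' [Es _]]]; last first.
  by rewrite Ea Es (infix_catl p (infix_catr s' (infix_refl f))).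
case/lastP: s Ea Ef => [|s x'] Ea Ef.
  by rewrite Eb Ef /= prefix_infix orbT.
case: s' Ef Eb => [|y' s'] Ef Eb.
  by rewrite Ea Ef cats0 suffix_infix.
move: Ea Eb; rewrite -rcons_cat => /rcons_inj[_ Ex] [Ey _].
move: sf; rewrite Ef -Ex -Ey cat_rcons => /cat_sorted2[_] /=.
by rewrite (negPf exy).
Qed.

(** The longest [e]-path starting the word. *)
Lemma run_prefix (e : rel T) x v : exists d b,
  [/\ v = d ++ b, path e x d & if b is y :: _ then ~~ e (last x d) y else true].
Proof.
elim: v x => [|y v IH] x; first by exists [::], [::].
case: (boolP (e x y)) => exy; last by exists [::], (y :: v).
by have [d [b [-> pd Hb]]] := IH y; exists (y :: d), b; rewrite /= exy.
Qed.

Lemma rot_traject (z : seq T) x : uniq z -> x \in z ->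
  exists i, rot i z = traject (next z) x (size z).
Proof.
move=> Uz /rot_to[i z' Ez]; exists i.
have := cycle_next Uz; rewrite -(rot_cycle i).
rewrite -(size_rot i z) Ez /= rcons_path => /andP[/fpathP[k ->] _].
by rewrite size_traject.
Qed.

End Words.

Section CyclicMonoids.
Variables m n : nat.
Notation gen := (gen m n).
Notation s := (gen_s m n).
Implicit Types (c : bool) (x y : gen) (a b p q v w : seq gen).

(** The two sides are indexed by [true] for the letters t and [false] for the
    letters u; s lies on both. *)
Definition on c x : bool :=
  match x with None => true | Some (inl _) => c | Some (inr _) => ~~ c end.

Definition side c : seq gen := if c then word_t m n else word_u m n.

Definition cyc c : seq gen := s :: side c.

Notation ccong c := (congruent (cyclic_relation (cyc c))).

Lemma mem_cyc c x : (x \in cyc c) = on c x.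
Proof.
rewrite /cyc /side in_cons; case: x => [[i|j]|] //=; case: c => /=.
- by rewrite map_f // mem_enum.
- by apply/mapP => -[].
- by apply/mapP => -[].
- by rewrite map_f // mem_enum.
Qed.

Lemma cyc_uniq c : uniq (cyc c).
Proof.
rewrite /cyc /side cons_uniq; case: c.
- apply/andP; split; first by apply/mapP => -[].
  by rewrite map_inj_uniq ?enum_uniq // => i j [].
- apply/andP; split; first by apply/mapP => -[].
  by rewrite map_inj_uniq ?enum_uniq // => i j [].
Qed.

Lemma ccong_cat c p q a b : ccong c p q -> ccong c a b -> ccong c (p ++ a) (q ++ b).
Proof. exact: congruent_cat. Qed.

Lemma ccong_catl c p a b : ccong c a b -> ccong c (p ++ a) (p ++ b).
Proof. exact: ccong_cat (congruent_refl _ _). Qed.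

Lemma ccong_catr c a p q : ccong c p q -> ccong c (p ++ a) (q ++ a).
Proof. by move=> /ccong_cat; apply; constructor. Qed.

Lemma ccong_rot c k : ccong c (rot k (cyc c)) (cyc c).
Proof.
apply: congruent_sym.
by have := congruent_rel [::] [::] (CyclicRelation (cyc c) k); rewrite !cats0.
Qed.

Lemma ccong_perm c a b : ccong c a b -> perm_eq a b.
Proof.
elim=> {a b} [a|a b _ IH|a b d _ IH1 _ IH2|p _ _ q [k]] //.
- by rewrite perm_sym.
- exact: perm_trans IH1 IH2.
- by rewrite perm_cat2l perm_cat2r perm_sym perm_rot.
Qed.

(** A letter [x] of the cycle is moved through [z] by rotating [z] so that it
    starts with [x]: then [z x = x z' x], and [z' x] is a rotation of [z]. *)
Lemma cyc_central c a : all (on c) a -> ccong c (cyc c ++ a) (a ++ cyc c).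
Proof.
elim: a => [|x a IH]; first by rewrite cats0; constructor.
case/andP; rewrite -mem_cyc => xc /IH{}IH.
apply: (@congruent_trans _ _ _ ([:: x] ++ cyc c ++ a)); last first.
  exact: ccong_catl IH.
rewrite -[x :: a]cat1s (catA (cyc c)) (catA [:: x]); apply: ccong_catr.
have [k z' Ez] := rot_to xc.
apply: (@congruent_trans _ _ _ (rot k (cyc c) ++ [:: x])).
  by apply: ccong_catr; apply/congruent_sym/ccong_rot.
rewrite Ez -cat1s -catA; apply: ccong_catl.
by rewrite cats1 -rot1_cons -Ez rot_rot_add; apply: ccong_rot.
Qed.

Definition cyc_free c a := forall k, ~~ infix (rot k (cyc c)) a.

(** No relation applies to a word without a rotation of the cycle as a factor. *)
Lemma cyc_free_ccong c a b : ccong c a b -> cyc_free c a \/ cyc_free c b -> a = b.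
Proof.
elim=> {a b} [a|a b _ IH [|]|a b d _ IH1 _ IH2 []|p _ _ q [k] []] //.
- by move=> ?; rewrite IH //; right.
- by move=> ?; rewrite IH //; left.
- by move=> fa; have E := IH1 (or_introl fa); rewrite E; apply: IH2; left; rewrite -E.
- by move=> fd; have E := IH2 (or_intror fd); rewrite -E; apply: IH1; right; rewrite E.
- by move/(_ 0); rewrite rot0 infix_infix.
- by move/(_ k); rewrite infix_infix.
Qed.

Lemma cyc_not_free c a : all (on c) a -> ~ cyc_free c a ->
  exists2 b, all (on c) b & ccong c a (cyc c ++ b).
Proof.
move=> ona /existsNP[k /negP]; rewrite negbK => /infixP[p [q Ea]].
move: ona; rewrite Ea !all_cat => /and3P[onp _ onq].
exists (p ++ q); first by rewrite all_cat onp.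
rewrite (catA p) (catA (cyc c)); apply: ccong_catr.
apply: congruent_trans _ (congruent_sym (cyc_central onp)).
by apply: ccong_catl; apply: ccong_rot.
Qed.

Lemma all_cyc c : all (on c) (cyc c).
Proof. by apply/allP => x; rewrite mem_cyc. Qed.

Lemma all_rot_cyc c k : all (on c) (rot k (cyc c)).
Proof. by rewrite (eq_all_r (mem_rot k _)) all_cyc. Qed.

Lemma all_ccong c a b : ccong c a b -> all (on c) a = all (on c) b.
Proof. by move/ccong_perm => /perm_all. Qed.

Lemma cyc_rot_sorted c k : sorted (frel (next (cyc c))) (rot k (cyc c)).
Proof.
have := cycle_next (cyc_uniq c); rewrite -(rot_cycle k).
by case: (rot _ _) => //= x v; rewrite rcons_path => /andP[].
Qed.

(** If [a] contains a rotation of the cycle, then the cycle itself divides [a]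
    and commutes with [w].  Otherwise [d] is the longest prefix of [a] that runs
    along the cycle, [a = d e].  If [w d] contains a rotation of the cycle, then
    the cycle divides [w d], and so does [d].  If not, then [w a] contains no
    rotation either, because a rotation cannot straddle the end of [d]; so
    [a q] and [w a] are the same word, of which both [d] and [w d] are
    prefixes. *)
Lemma cyclic_property_P c a w q :
  all (on c) a -> all (on c) w -> a != [::] ->
  ccong c (a ++ q) (w ++ a) ->
  exists d e g q',
    [/\ d != [::], ccong c a (d ++ e), ccong c (d ++ g) (cyc c)
      & ccong c (w ++ d) (d ++ q')].
Proof.
move=> ona onw a0 awq.
case: (EM (cyc_free c a)) => [fa|/(cyc_not_free ona)[e one ae]]; last first.
  exists (cyc c), e, [::], w; split=> //; last exact/congruent_sym/cyc_central.
  by rewrite cats0; constructor.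
case: a a0 ona awq fa => // x v _ onxv awq fa.
have [d' [e [Ev pd Hb]]] := run_prefix (frel (next (cyc c))) x v.
have xz : x \in cyc c by rewrite mem_cyc; case/andP: onxv.
have [i Ei] := rot_traject (cyc_uniq c) xz.
have Ed : x :: d' = traject (next (cyc c)) x (size (x :: d')).
  by case/fpathP: pd => k ->; rewrite /= size_traject.
have Ea : x :: v = (x :: d') ++ e by rewrite Ev.
have lt_d : size (x :: d') < size (cyc c).
  rewrite ltnNge; apply/negP => le; have /negP := fa i; apply.
  rewrite Ea Ei; apply: infix_catr.
  by rewrite Ed -(subnKC le) trajectD prefix_infix.
set d := x :: d' in Ed Ea lt_d *.
pose g := drop (size d) (rot i (cyc c)).
have Edg : d ++ g = rot i (cyc c).
  rewrite /g -[RHS](cat_take_drop (size d)); congr (_ ++ _).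
  by rewrite Ei take_traject // ltnW.
have dg : ccong c (d ++ g) (cyc c) by rewrite Edg; apply: ccong_rot.
have ond : all (on c) d by move: onxv; rewrite Ea all_cat => /andP[].
case: (EM (cyc_free c (w ++ d))) => [fwd|].
  have fwde : cyc_free c (w ++ d ++ e).
    case: e {Ev} Hb Ea => [|y e] Hb Ea; first by rewrite cats0.
    move=> k; apply/negP; rewrite /d lastI catA -rcons_cat.
    move/(infix_break (cyc_rot_sorted c k) Hb); rewrite rcons_cat -lastI -/d.
    rewrite (negPf (fwd k)) /= => inf; have /negP := fa k; apply.
    by rewrite Ea; apply: infix_catl.
  have E : (x :: v) ++ q = w ++ x :: v.
    by apply: (cyc_free_ccong awq); right; rewrite Ea.
  exists d, e, g, (drop (size d) (w ++ d)); split=> //.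
    by rewrite Ea; constructor.
  move: E; rewrite Ea -catA => /(congr1 (take (size d))).
  rewrite take_size_cat // catA takel_cat ?size_cat ?leq_addl // => E.
  by rewrite -{1}[w ++ d](cat_take_drop (size d)) -E; constructor.
move/cyc_not_free; rewrite all_cat onw ond => /(_ isT)[r onr wdr].
exists d, e, g, (g ++ r); split=> //; first by rewrite Ea; constructor.
apply: congruent_trans wdr _; rewrite catA.
by apply: ccong_catr; apply: congruent_sym.
Qed.

Definition proj c a := filter (on c) a.

Notation ns := (count_mem s).
Notation cong := (congruent (@Gmn_relation m n)).

Lemma negb_neq c c' : c' != c -> c' = ~~ c.
Proof. by case: c c' => [] []. Qed.

Lemma proj_cat c a b : proj c (a ++ b) = proj c a ++ proj c b.
Proof. exact: filter_cat. Qed.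

Lemma all_proj c a : all (on c) (proj c a).
Proof. exact: filter_all. Qed.

Lemma proj_id c a : all (on c) a -> proj c a = a.
Proof. by move/all_filterP. Qed.

Lemma count_proj c a : ns (proj c a) = ns a.
Proof.
by rewrite count_filter; apply: eq_count => -[[i|j]|] //=; rewrite andbF.
Qed.

Lemma on_other c x : x != s -> on (~~ c) x = ~~ on c x.
Proof. by case: x => [[i|j]|] //; rewrite /= ?negbK. Qed.

Lemma proj_no_s c a : all (on (~~ c)) a -> ns a = 0 -> proj c a = [::].
Proof.
move=> ona /eqP; rewrite -leqn0 leqNgt -has_count has_pred1 => sa.
apply/eqP; rewrite -[_ == _]negbK -has_filter; apply/hasPn => x xa.
have xs : x != s by apply: contraNneq sa => <-.
by rewrite -[c]negbK on_other // negbK (allP ona).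
Qed.

(** The occurrence number [k] of s, counted from 0. *)
Lemma split_at k a : k < ns a -> exists p q, a = p ++ s :: q /\ ns p = k.
Proof.
elim: a k => //= x a IH k; case: (eqVneq x s) => [->|xs] /=; last first.
  case/IH=> [p [q [-> <-]]]; exists (x :: p), q.
  by rewrite /= (negPf xs).
case: k => [|k] lt_k; first by exists [::], a.
have [|p [q [-> <-]]] := IH k; first by [].
by exists (s :: p), q.
Qed.

(** The two words are shuffled block by block, the blocks being delimited by
    the occurrences of s, which are shared. *)
Lemma lift_pair c p q : all (on c) p -> all (on (~~ c)) q -> ns p = ns q ->
  exists2 w, proj c w = p & proj (~~ c) w = q.
Proof.
elim: p q => [|x p IH] q.
  move=> _ onq /esym nsq; exists q; last exact: proj_id.
  exact: proj_no_s nsq.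
case/andP=> onx onp onq; case: (eqVneq x s) => [->|xs].
  rewrite /= => nsE.
  have [|q1 [q2 [Eq nq1]]] := @split_at 0 q; first by rewrite -nsE.
  move: onq nsE; rewrite Eq all_cat => /and3P[onq1 _ onq2].
  rewrite count_cat nq1 /= => -[] nsE.
  have [w Ep Eq2] := IH _ onp onq2 nsE.
  exists (q1 ++ s :: w); rewrite proj_cat /=; first by rewrite proj_no_s //= Ep.
  by rewrite (proj_id onq1) Eq2.
rewrite /= (negPf xs) => /IH-/(_ onp onq)[w Ep Eq].
by exists (x :: w); rewrite /= ?onx ?Ep // on_other // onx.
Qed.

Lemma proj_lift (f : bool -> seq gen) :
  (forall c, all (on c) (f c)) -> ns (f true) = ns (f false) ->
  exists w, forall c, proj c w = f c.
Proof.
move=> onf nsf; have [w Et Ef] := @lift_pair true _ _ (onf true) (onf false) nsf.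
by exists w => -[].
Qed.

Lemma cong_cat p q a b : cong p q -> cong a b -> cong (p ++ a) (q ++ b).
Proof. exact: congruent_cat. Qed.

Lemma cong_catl p a b : cong a b -> cong (p ++ a) (p ++ b).
Proof. exact: cong_cat (congruent_refl _ _). Qed.

Lemma cong_catr a p q : cong p q -> cong (p ++ a) (q ++ a).
Proof. by move=> /cong_cat; apply; constructor. Qed.

Lemma cong_comm c x y : on c x -> on (~~ c) y -> x != s -> y != s ->
  cong [:: y; x] [:: x; y].
Proof.
move=> onx ony xs ys.
suff H i j : cong [:: gen_t n i; gen_u m j] [:: gen_u m j; gen_t n i].
  case: x y onx ony xs ys => [[i|j]|] [[i'|j']|] //=; case: c => // _ _ _ _.
    exact/congruent_sym/H.
  exact: H.
have R := Gmn_relation_tu (CyclicRelation [:: gen_t n i; gen_u m j] 1).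
exact: (congruent_rel [::] [::] R).
Qed.

Lemma cong_comm_word c x p : on c x -> x != s -> proj c p = [::] ->
  cong (p ++ [:: x]) (x :: p).
Proof.
move=> onx xs; elim: p => [|y p IH] /=; first by constructor.
case: ifP => // ony /IH{}IH.
apply: (@congruent_trans _ _ _ ([:: y; x] ++ p)).
  exact: (cong_cat (congruent_refl _ [:: y]) IH).
apply: (cong_cat (q := [:: x; y]) _ (congruent_refl _ p)).
have ys : y != s by apply: contraFneq ony => ->.
by apply: (cong_comm onx) => //; rewrite on_other // ony.
Qed.

Lemma proj_cons_split c x p a : proj c a = x :: p ->
  exists a1 a2, [/\ a = a1 ++ x :: a2, proj c a1 = [::] & proj c a2 = p].
Proof.
elim: a => //= y a IH; case: ifP => [_ [-> Ep]|ony /IH[a1 [a2 [-> E1 E2]]]].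
  by exists [::], a.
by exists (y :: a1), a2; rewrite /= ony.
Qed.

(** A letter other than s that comes first in one projection commutes with all
    that precedes it in the word, so words with the same projections are equal
    up to the commutations of the t with the u. *)
Lemma cong_proj_eq a b : (forall c, proj c a = proj c b) -> cong a b.
Proof.
elim: a b => [|x a IH] b Eab.
  case: b Eab => [|y b] Eab; first by constructor.
  by case: y Eab => [[i|j]|] Eab; [have := Eab true|have := Eab false|have := Eab true].
case: (eqVneq x s) => [Ex|xs].
  rewrite {}Ex in Eab *; case: b Eab => [|y b] Eab; first by have := Eab true.
  have Ey : y = s.
    by case: y Eab => [[i|j]|] Eab //; [have := Eab true|have := Eab false].
  rewrite {}Ey in Eab *; apply: (cong_cat (congruent_refl _ [:: s])).
  by apply: IH => c; have := Eab c; case.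
have [c onx] : exists c, on c x.
  by case: x {Eab xs} => [[]|]; [exists true|exists false|exists true].
have := Eab c; rewrite /= onx => /esym/proj_cons_split[b1 [b2 [Eb E1 E2]]].
apply: (@congruent_trans _ _ _ (x :: b1 ++ b2)).
  apply: (cong_cat (congruent_refl _ [:: x])); apply: IH => c'.
  case: (eqVneq c' c) => [->|nc]; first by rewrite proj_cat E1 E2.
  rewrite (negb_neq nc).
  have := Eab (~~ c); rewrite /= on_other // onx /= => ->.
  by rewrite Eb !proj_cat /= on_other // onx.
rewrite Eb -cat1s catA -[x :: b2]cat1s catA; apply: cong_catr.
exact/congruent_sym/(cong_comm_word onx).
Qed.

Lemma all_side c : all (fun x => (x != s) && on c x) (side c).
Proof. by apply/allP => x; rewrite /side; case: (c) => /mapP[i _ ->]. Qed.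

Lemma proj_other_side c : proj (~~ c) (side c) = [::].
Proof.
apply/eqP; rewrite -[_ == _]negbK -has_filter; apply/hasPn => x.
by move/(allP (all_side c))/andP => [xs onx]; rewrite on_other // negbK.
Qed.

Lemma proj_other_rot c k : proj (~~ c) (rot k (cyc c)) = [:: s].
Proof.
apply/perm_small_eq => //; apply: (@perm_trans _ (proj (~~ c) (cyc c))).
  by apply/perm_filter; rewrite perm_rot.
by rewrite /proj /cyc /= -/(proj _ _) proj_other_side.
Qed.

Lemma cong_cyc c k : cong (cyc c) (rot k (cyc c)).
Proof.
have R : Gmn_relation (cyc c) (rot k (cyc c)).
  by case: c; [apply: Gmn_relation_st | apply: Gmn_relation_su].
by have := congruent_rel [::] [::] R; rewrite !cats0.
Qed.

(** A relation applied in one projection can be applied in the word: cut the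
    other projection at the same occurrence of s, and lift the pieces so that
    the rotated cycle is a factor of the lifted word. *)
Lemma cong_proj_step c p q : ccong c p q -> all (on c) p ->
  forall a b, proj c a = p -> proj c b = q -> proj (~~ c) a = proj (~~ c) b -> cong a b.
Proof.
elim=> {p q} [p|p q pq IH|p q r pq IH1 qr IH2|p _ _ q [k]] onp a b Ea Eb Eab.
- apply: cong_proj_eq => c'; case: (eqVneq c' c) => [->|nc]; first by rewrite Ea Eb.
  by rewrite (negb_neq nc).
- by apply/congruent_sym/IH => //; rewrite (all_ccong pq).
- have onq : all (on c) q by rewrite -(all_ccong pq).
  have nsq : ns q = ns (proj (~~ c) a).
    by rewrite -(permP (ccong_perm pq)) -Ea !count_proj.
  have [d Ed Ed'] := lift_pair onq (all_proj _ _) nsq.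
  apply: (@congruent_trans _ _ _ d); first exact: IH1.
  by apply: IH2 => //; rewrite Ed'.
(* The occurrence of s inside the cycle that follows [p] is number [ns p]. *)
have nsa : ns p < ns (proj (~~ c) a).
  rewrite count_proj -(count_proj c a) Ea !count_cat /cyc /= -addnA.
  by rewrite -[X in X < _]addn0 ltn_add2l.
have [p' [q' [Epq nsp]]] := split_at nsa.
move: onp; rewrite !all_cat => /and3P[onp _ onq].
have : all (on (~~ c)) (proj (~~ c) a) by apply: all_proj.
rewrite Epq all_cat => /and3P[onp' _ onq'].
have nsq : ns q = ns q'.
  have nsc : ns (cyc c) = 1.
    by rewrite -(count_proj (~~ c)) -[cyc c]rot0 proj_other_rot.
  have := count_proj (~~ c) a; rewrite Epq -(count_proj c a) Ea !count_cat nsp nsc.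
  by move/addnI/(congr1 predn)/esym.
have [u Eu Eu'] := lift_pair onp onp' (esym nsp).
have [v Ev Ev'] := lift_pair onq onq' nsq.
have Ez k' : proj c (rot k' (cyc c)) = rot k' (cyc c).
  by apply/proj_id/all_rot_cyc.
have cong_lift k' d : proj c d = p ++ rot k' (cyc c) ++ q ->
    proj (~~ c) d = proj (~~ c) a -> cong d (u ++ rot k' (cyc c) ++ v).
  move=> Ed Ed'; apply: cong_proj_eq => c'; case: (eqVneq c' c) => [->|nc].
    by rewrite Ed (proj_cat _ u) (proj_cat _ (rot _ _)) Eu Ev Ez.
  rewrite (negb_neq nc).
  by rewrite Ed' Epq (proj_cat _ u) (proj_cat _ (rot _ _)) Eu' Ev' proj_other_rot.
apply: congruent_trans (cong_lift 0 a _ (erefl _)) _; first by rewrite rot0.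
apply: congruent_trans _ (congruent_sym (cong_lift k b _ (esym Eab))) => //.
apply: cong_catl; apply: cong_catr.
by rewrite rot0; apply: cong_cyc.
Qed.

(** A relation either is invisible on the side [c] or is the cyclic relation of
    that side. *)
Lemma relation_cases c l r : Gmn_relation l r ->
  proj c l = proj c r \/ exists k, l = cyc c /\ r = rot k (cyc c).
Proof.
have H c' k : proj c (cyc c') = proj c (rot k (cyc c')) \/
    exists k', cyc c' = cyc c /\ rot k (cyc c') = rot k' (cyc c).
  case: (eqVneq c' c) => [->|nc]; first by right; exists k.
  rewrite eq_sym in nc; rewrite (negb_neq nc).
  by left; rewrite -[in LHS](rot0 (cyc c')) !proj_other_rot.
case=> [{}l {}r [k]|{}l {}r [k]|i j {}l {}r [k]].
- exact: (H true).
- exact: (H false).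
left; apply/esym/perm_small_eq; first by case: c H.
by apply/perm_filter; rewrite perm_rot.
Qed.

Lemma ccong_proj c a b : cong a b -> ccong c (proj c a) (proj c b).
Proof.
elim=> {a b} [a|a b _|a b d _ IH1 _ IH2|p l r q lr]; first by constructor.
- exact: congruent_sym.
- exact: congruent_trans IH1 IH2.
rewrite !proj_cat; apply: ccong_catl.
apply: ccong_catr.
case: (relation_cases c lr) => [->|[k [-> ->]]]; first by constructor.
rewrite !proj_id ?all_rot_cyc ?all_cyc //.
exact/congruent_sym/ccong_rot.
Qed.

(** The monoid is the fibre product of the two cyclic monoids. *)
Lemma congP a b : cong a b <-> forall c, ccong c (proj c a) (proj c b).
Proof.
split=> [ab c|ab]; first exact: ccong_proj.
have nsE : ns (proj true b) = ns (proj false a).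
  by rewrite -(permP (ccong_perm (ab true))) !count_proj.
have [d Et Ef] := @lift_pair true _ _ (all_proj true b) (all_proj false a) nsE.
apply: (@congruent_trans _ _ _ d).
  exact: (cong_proj_step (ab true) (all_proj _ _)).
exact: (cong_proj_step (c := false) (ab false) (all_proj _ _)).
Qed.

End CyclicMonoids.

(** * Common factors with Delta *)

(** These identities are stated for abstract groups, to be applied to classes
    whose product is displayed as that of the underlying presented monoid. *)
Lemma conjg_eq_mul (G : groupType) (x y g : G) :
  (x ^ g = y -> g^-1 * x = y * g^-1)%g.
Proof. by move=> <-; rewrite conjgE !mulgA mulgK. Qed.

Lemma mul_eq_conjg (G : groupType) (x y a : G) :
  (a * x = y * a -> x ^ a^-1 = y)%g.
Proof. by move=> E; rewrite conjgE invgK mulgA E mulgK. Qed.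

Section PropertyP.
Variables m n : nat.
Notation gen := (gen m n).
Notation s := (gen_s m n).
Notation ns := (count_mem s).
Notation cong := (congruent (@Gmn_relation m n)).
Notation ccong c := (congruent (cyclic_relation (@cyc m n c))).
Notation cl := (class_of (@Gmn_relation m n)).
Notation Gm := (Gmn_monoid m n).
Local Open Scope group_scope.

Lemma proj_Delta c : proj c ((s :: word_t m n) ++ word_u m n) = cyc m n c.
Proof.
have Et : proj c (word_t m n) = if c then word_t m n else [::].
  by case: c; rewrite /proj /word_t; elim: (enum _) => //= i r ->.
have Eu : proj c (word_u m n) = if c then [::] else word_u m n.
  by case: c {Et}; rewrite /proj /word_u; elim: (enum _) => //= i r ->.
by rewrite proj_cat /= -/(proj c _) Et Eu /cyc /side; case: ifP; rewrite ?cats0.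
Qed.

(** The projected form of the conclusion of the property P, where [d] is the
    divisor and [e], [g], [q] are the cofactors. *)
Definition Trans_factor c (a w d e g q : seq gen) : Prop :=
  [/\ ccong c (proj c a) (d ++ e), ccong c (d ++ g) (cyc m n c)
    & ccong c (proj c w ++ d) (d ++ q)].

Lemma Trans_factor_nil c a w :
  Trans_factor c a w [::] (proj c a) (cyc m n c) (proj c w).
Proof. by split; rewrite ?cats0; constructor. Qed.

Lemma count_cyc c : ns (cyc m n c) = 1%N.
Proof. by rewrite -(count_proj (~~ c)) -[cyc _ _ c]rot0 proj_other_rot. Qed.

Lemma Trans_factor_all c a w d e g q : Trans_factor c a w d e g q ->
  [/\ all (on c) d, all (on c) e, all (on c) g & all (on c) q].
Proof.
case=> H1 H2 H3; move: (all_proj c a); rewrite (all_ccong H1) all_cat => /andP[-> ->].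
move: (all_cyc m n c); rewrite -(all_ccong H2) all_cat => /andP[ond ->].
move: (all_proj c w) => onw; have : all (on c) (proj c w ++ d) by rewrite all_cat onw.
by rewrite (all_ccong H3) all_cat => /andP[_ ->].
Qed.

Lemma Trans_factor_count c a w d e g q : Trans_factor c a w d e g q ->
  [/\ ns a = ns d + ns e, 1%N = ns d + ns g & ns w = ns q].
Proof.
case=> /ccong_perm/permP/(_ (pred1 s)) H1 /ccong_perm/permP/(_ (pred1 s)) H2.
move=> /ccong_perm/permP/(_ (pred1 s)).
rewrite !count_cat !count_proj count_cyc in H1 H2 *.
by rewrite addnC => /addnI ->; split.
Qed.

(** Counting s shows that the cofactors on the two sides match as well, so all
    of them lift. *)
Lemma Trans_factor_combine (a w : seq gen) (d e g q : bool -> seq gen) :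
  (forall c, Trans_factor c a w (d c) (e c) (g c) (q c)) ->
  ns (d true) = ns (d false) -> (exists c, d c != [::]) ->
  exists D : Gm,
    [/\ Trans (cl w : Gm) D, left_divides D (cl a) & left_divides D (Delta m n)].
Proof.
move=> H nsd [c0 d0].
have Hall c := Trans_factor_all (H c); have Hc c := Trans_factor_count (H c).
have [D ED] : exists D, forall c, proj c D = d c.
  by apply: proj_lift => // c; case: (Hall c).
have [E EE] : exists E, forall c, proj c E = e c.
  apply: proj_lift => [c|]; first by case: (Hall c).
  have [E1 _ _] := Hc true; have [E2 _ _] := Hc false.
  by apply/(@addnI (ns (d true))); rewrite -E1 E2 nsd.
have [G EG] : exists G, forall c, proj c G = g c.
  apply: proj_lift => [c|]; first by case: (Hall c).
  have [_ E1 _] := Hc true; have [_ E2 _] := Hc false.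
  by apply/(@addnI (ns (d true))); rewrite -E1 E2 nsd.
have [Q EQ] : exists Q, forall c, proj c Q = q c.
  apply: proj_lift => [c|]; first by case: (Hall c).
  by have [_ _ <-] := Hc true; have [_ _ <-] := Hc false.
exists (cl D); split.
- split.
    rewrite -class_of1 => /class_ofP/congP/(_ c0)/ccong_perm.
    by rewrite ED => /perm_nilP/eqP; rewrite (negPf d0).
  exists (cl Q); rewrite -!class_ofM; apply/class_ofP/congP => c.
  by rewrite !proj_cat ED EQ; have [_ _ /congruent_sym] := H c.
- exists (cl E); rewrite -class_ofM; apply/class_ofP/congP => c.
  by rewrite !proj_cat ED EE; have [] := H c.
- exists (cl G); rewrite -class_ofM; apply/class_ofP/congP => c.
  by rewrite proj_Delta proj_cat ED EG; have [_ /congruent_sym] := H c.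
Qed.

Theorem property_P_Delta (w : Gm) : property_P w (Delta m n).
Proof.
have [w' ->] := class_of_surj w; move=> A [A1 [Q]].
have [a Ea] := class_of_surj A; have [q ->] := class_of_surj Q.
rewrite {}Ea in A1 *; rewrite -!class_ofM => /class_ofP/congP E.
have H c : exists d e g q',
    Trans_factor c a w' d e g q' /\ (proj c a != [::] -> d != [::]).
  case: (eqVneq (proj c a) [::]) => [a0|a0].
    exists [::], (proj c a), (cyc m n c), (proj c w').
    by split; first exact: Trans_factor_nil.
  have := E c; rewrite !proj_cat.
  case/(cyclic_property_P (all_proj c a) (all_proj c w') a0).
  move=> d [e [g [q' [d0 H1 H2 H3]]]].
  by exists d, e, g, q'.
have [d /choice[e /choice[g /choice[q' {}H]]]] := choice H.
have Hg c : Trans_factor c a w' (d c) (e c) (g c) (q' c) by case: (H c).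
have Hc c := Trans_factor_count (Hg c).
(* A nontrivial divisor without s on one side is paired with 1 on the other;
   otherwise both divisors contain s exactly once. *)
case: (EM (exists2 c, d c != [::] & ns (d c) = 0)) => [[c d0 nsd]|Hd].
  pose f T (x y : bool -> T) c' := if c' == c then x c' else y c'.
  apply: (@Trans_factor_combine a w' (f _ d (fun _ => [::])) (f _ e (fun c => proj c a))
           (f _ g (cyc m n)) (f _ q' (fun c => proj c w'))).
  - by move=> c'; rewrite /f; case: ifP => // _; apply: Trans_factor_nil.
  - by rewrite /f; case: c {f d0} nsd => /=.
  - by exists c; rewrite /f eqxx.
have nsa : ns a != 0.
  apply/eqP => nsa; apply: A1; apply/class_ofP/cong_proj_eq => c.
  apply/eqP; rewrite -[_ == _]negbK; apply/negP => /(proj2 (H c)) d0.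
  apply: Hd; exists c => //; have [+ _ _] := Hc c.
  by rewrite nsa => /esym/eqP; rewrite addn_eq0 => /andP[/eqP].
have Hne c : d c != [::].
  by apply: (proj2 (H c)); apply: contraNneq nsa => a0; rewrite -(count_proj c) a0.
have nsd c : ns (d c) = 1%N.
  have [_ E1 _] := Hc c; case E0 : (ns (d c)) E1 => [|[|k]] //.
  by case: Hd; exists c.
apply: (Trans_factor_combine Hg); first by rewrite !nsd.
by exists true.
Qed.

Lemma Delta_central (A : Gm) : Delta m n * A = A * Delta m n.
Proof.
have [a ->] := class_of_surj A; rewrite -!class_ofM; apply/class_ofP/congP => c.
by rewrite (proj_cat _ _ a) (proj_cat _ a) proj_Delta; apply/cyc_central/all_proj.
Qed.

(** On a side containing [x] the complement is the rest of the cycle read from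
    [x]; on the other side it is the whole cycle. *)
Lemma letter_complement (x : gen) : exists y : Gm,
  cl [:: x] * y = Delta m n /\ y * cl [:: x] = Delta m n.
Proof.
have H c : exists g : seq gen, [/\ all (on c) g, ns g = (x != s),
    ccong c (proj c [:: x] ++ g) (cyc m n c)
    & ccong c (g ++ proj c [:: x]) (cyc m n c)].
  case onx : (on c x); last first.
    have -> : proj c [:: x] = [::] by rewrite /= onx.
    exists (cyc m n c); rewrite all_cyc count_cyc cats0.
    split=> //; try constructor.
    by rewrite (_ : x != s) //; apply: contraFneq onx => ->.
  have xc : x \in cyc m n c by rewrite mem_cyc.
  have [k z' Ez] := rot_to xc; exists z'.
  have -> : proj c [:: x] = [:: x] by rewrite /= onx.
  have := all_rot_cyc m n c k; rewrite Ez /= => /andP[_ onz]; split=> //.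
  - have := count_cyc c; rewrite -(permP (permEl (perm_rot k _))) Ez /=.
    by case: eqP => //= _ [].
  - by rewrite -Ez; apply: ccong_rot.
  - by rewrite cats1 -rot1_cons -Ez rot_rot_add; apply: ccong_rot.
have [f Hf] := choice H.
have [y Ey] : exists y, forall c, proj c y = f c.
  apply: proj_lift => [c|]; first by case: (Hf c).
  by have [_ -> _ _] := Hf true; have [_ -> _ _] := Hf false.
exists (cl y); rewrite -!class_ofM; split; apply/class_ofP/congP => c;
  by rewrite proj_Delta proj_cat Ey; have [] := Hf c.
Qed.

Notation gcong := (congruent (group_relation (@Gmn_relation m n))).
Notation gcl := (class_of (group_relation (@Gmn_relation m n))).
Notation Gg := (Gmn_group m n).

Lemma positive_cat (x y : seq gen) :
  positive_word (x ++ y) = positive_word x ++ positive_word y.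
Proof. exact: map_cat. Qed.

Lemma count_pos (x : seq gen) : count snd (positive_word x) = 0.
Proof. by rewrite count_map (eq_count (a2 := pred0)) ?count_pred0. Qed.

Lemma cong_positive (x y : seq gen) :
  cong x y -> gcong (positive_word x) (positive_word y).
Proof.
elim=> {x y} [x|x y _|x y z _ H1 _ H2|p l r q lr]; first by constructor.
- exact: congruent_sym.
- exact: congruent_trans H1 H2.
rewrite !positive_cat; apply: congruent_rel.
exact: group_relation_rel.
Qed.

Lemma DeltaX_central k (A : Gm) : Delta m n ^+ k * A = A * Delta m n ^+ k.
Proof.
elim: k => [|k IH]; first by rewrite expg0 mul1g mulg1.
by rewrite expgS -mulgA IH !mulgA Delta_central.
Qed.

(** Replace each inverse letter by the complement of the letter in Delta.  The
    resulting [L x] represents [x] times the power of Delta whose exponent is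
    the number of inverse letters of [x]. *)
Lemma group_fraction : exists L : seq (gen * bool) -> Gm,
  [/\ forall x y, L (x ++ y) = L x * L y, forall x, L (positive_word x) = cl x
    & forall x y, gcong x y -> exists k l,
        k + count snd x = l + count snd y /\
        Delta m n ^+ k * L x = Delta m n ^+ l * L y].
Proof.
have [comp Hcomp] := choice letter_complement.
pose l1 (a : gen * bool) : Gm := if a.2 then comp a.1 else cl [:: a.1].
pose L x : Gm := foldr (fun a r => l1 a * r) 1 x.
have Lcat x y : L (x ++ y) = L x * L y.
  by elim: x => [|a x IH] /=; rewrite ?mul1g // IH mulgA.
have Lpos x : L (positive_word x) = cl x.
  by elim: x => [|a x IH] //=; rewrite IH /l1 /= -class_ofM.
exists L; split=> // x y; elim=> {x y}.
- by move=> x; exists 0, 0.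
- by move=> x y _ [k [l [E1 E2]]]; exists l, k.
- move=> x y z _ [k [l [E1 E2]]] _ [k' [l' [E3 E4]]]; exists (k' + k), (l + l').
  split; first by rewrite -addnA E1 addnCA E3 addnA.
  by rewrite !expgnDr -!mulgA E2 -E4 !mulgA (DeltaX_central k' (_ ^+ l)).
- move=> p _ _ q [l r lr|a e].
    exists 0, 0; split; last first.
      congr (_ * _); rewrite !Lcat !Lpos (_ : cl l = cl r) //.
      apply/class_ofP; rewrite -[l]cats0 -[r]cats0; exact: (congruent_rel [::] [::] lr).
    rewrite !count_cat; congr (_ + (_ + (_ + _))).
    by rewrite !count_pos.
exists 0, 1%N; split.
  rewrite !count_cat (_ : count _ [:: _; _] = 1%N) ?add0n 1?addnCA //.
  by case: (e).
have Ea : L [:: (a, e); (a, ~~ e)] = Delta m n.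
  by rewrite /= mulg1 /l1; have [E1 E2] := Hcomp a; case: e.
rewrite expg0 mul1g expg1 !Lcat Ea mul1g !mulgA -Delta_central //.
Qed.

(** A conjugator [w] in the group gives the conjugator [Delta^l L(w)] in the
    monoid: [w U] and [V w] have equally many inverse letters, so they become
    equal after multiplication by the same power of Delta. *)
Lemma monoid_conj_group (U V : seq gen) :
  (exists a : Gm, a * cl U = cl V * a) <->
  (exists g : Gg, (gcl (positive_word U) : Gg) ^ g = gcl (positive_word V)).
Proof.
split=> [[A]|[g E]].
  have [a ->] := class_of_surj A.
  rewrite -!class_ofM => /class_ofP/cong_positive/class_ofP.
  rewrite !positive_cat !class_ofM => E; exists (gcl (positive_word a) : Gg)^-1.
  have E' : (gcl (positive_word a) : Gg) * gcl (positive_word U) =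
    gcl (positive_word V) * gcl (positive_word a) by exact: E.
  exact: mul_eq_conjg E'.
have [L [Lcat Lpos HL]] := group_fraction.
have [w Ew] := class_of_surj (g^-1 : Gg).
have : gcong (w ++ positive_word U) (positive_word V ++ w).
  have E' : g^-1 * (gcl (positive_word U) : Gg) = gcl (positive_word V) * g^-1.
    exact: (conjg_eq_mul E).
  by apply/class_ofP; rewrite !class_ofM -Ew; apply: E'.
case/HL => k [l []]; rewrite !count_cat [X in _ = (_ + X)%N]addnC => nkl E2.
have {nkl}Ekl : k = l by move: nkl; rewrite count_pos count_pos => /addIn.
rewrite {}Ekl !Lcat !Lpos !mulgA in E2.
by exists (Delta m n ^+ l * L w); rewrite E2 (DeltaX_central l (cl V)) mulgA.
Qed.

End PropertyP.

(** * The group as a product of free groups *)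

Section Evaluation.
Local Open Scope group_scope.
Variables (A : choiceType) (G : groupType) (beta : A -> G).
Implicit Types (a b : A * bool) (w x y z : seq (A * bool)).

Definition eval_letter a : G := if a.2 then (beta a.1)^-1 else beta a.1.

Definition eval w : G := \prod_(a <- w) eval_letter a.

Lemma eval_cat x y : eval (x ++ y) = eval x * eval y.
Proof. exact: big_cat. Qed.

Lemma eval_cons a x : eval (a :: x) = eval_letter a * eval x.
Proof. exact: big_cons. Qed.

Lemma eval_nil : eval [::] = 1.
Proof. exact: big_nil. Qed.

Lemma eval_flip a : eval_letter (flip a) = (eval_letter a)^-1.
Proof. by case: a => a []; rewrite /eval_letter //= invgK. Qed.

Lemma eval_inv x : eval (inv_word x) = (eval x)^-1.
Proof.
elim: x => [|a x IH]; first by rewrite eval_nil invg1.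
by rewrite inv_word_cons -cats1 eval_cat !eval_cons eval_nil mulg1 IH eval_flip invgM.
Qed.

Lemma eval_push a x : eval (push a x) = eval_letter a * eval x.
Proof.
rewrite /push; case: eqP => [|_]; last by rewrite eval_cons.
case: x => [/eqP|b x /= ->] /=; first by rewrite flip_neq.
by rewrite eval_cons eval_flip mulVKg.
Qed.

Lemma eval_act x y : eval (act x y) = eval x * eval y.
Proof.
elim: x => [|a x IH] /=; first by rewrite eval_nil mul1g.
by rewrite eval_push IH eval_cons mulgA.
Qed.

Lemma eval_conj_head x : exists z, eval (conj_head x) = eval x ^ eval z.
Proof.
case: x => [|a x]; first by exists [::]; rewrite eval_nil conjg1.
exists [:: a]; rewrite /= eval_act !eval_cons eval_nil mulg1 conjgE.
by rewrite mulgA mulKg.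
Qed.

Lemma eval_iter_conj_head n x :
  exists z, eval (iter n (@conj_head A) x) = eval x ^ eval z.
Proof.
elim: n => [|n [z Ez]]; first by exists [::]; rewrite eval_nil conjg1.
have [z' Ez'] := eval_conj_head (iter n (@conj_head A) x).
by exists (z ++ z'); rewrite /= Ez' Ez eval_cat conjgM.
Qed.

Lemma eval_free_conj x y : free_conj x y -> exists z, eval x ^ eval z = eval y.
Proof.
case=> i [j E]; have [z Ez] := eval_iter_conj_head i (freduce x).
have [z' Ez'] := eval_iter_conj_head j (freduce y).
move: Ez Ez'; rewrite E => -> E2; exists (z ++ inv_word z').
move: E2; rewrite /freduce !eval_act !eval_nil !mulg1 => E2.
by rewrite eval_cat eval_inv conjgM E2 conjgK.
Qed.

Lemma commute_eval g w : (forall x : A, commute g (beta x)) -> commute g (eval w).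
Proof.
move=> H; elim: w => [|a w IH]; first by rewrite eval_nil; apply: commute1.
rewrite eval_cons; apply: commuteM => //.
by rewrite /eval_letter; case: ifP => _; [apply: commuteV|].
Qed.

End Evaluation.

Lemma conjg_eq_mulr (G : groupType) (x y g : G) : (x ^ g = y -> g * y = x * g)%g.
Proof. by move=> <-; rewrite -conjgC. Qed.

Section SignedWords.
Local Open Scope group_scope.
Variables (A B : choiceType) (h : A -> seq (B * bool)).

Definition signed (a : A * bool) := if a.2 then inv_word (h a.1) else h a.1.

Definition signed_hom (x : seq (A * bool)) := flatten (map signed x).

Lemma signed_hom_cat x y : signed_hom (x ++ y) = signed_hom x ++ signed_hom y.
Proof. by rewrite /signed_hom map_cat flatten_cat. Qed.

Lemma signed_hom_inv x : signed_hom (inv_word x) = inv_word (signed_hom x).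
Proof.
elim: x => // a x IH; rewrite inv_word_cons -cats1 signed_hom_cat IH.
rewrite {3}/signed_hom /= -/(signed_hom x) inv_word_cat; congr (_ ++ _).
by case: a => a []; rewrite /signed_hom /= cats0 /signed /= ?inv_wordK.
Qed.

Lemma signed_hom_positive x : signed_hom (positive_word x) = flatten (map h x).
Proof. by rewrite /signed_hom -map_comp; congr flatten; apply: eq_map. Qed.

Variable R : seq A -> seq A -> Prop.
Hypothesis h_rel : forall l r, R l r -> forall st, reduced st ->
  act (flatten (map h l)) st = act (flatten (map h r)) st.

Lemma act_congruent x y : congruent (group_relation R) x y ->
  forall st, reduced st -> act (signed_hom x) st = act (signed_hom y) st.
Proof.
elim=> {x y} // [x y _ IH|x y z _ IH1 _ IH2|p l r q lr] st red_st.
- by rewrite IH.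
- by rewrite IH1 ?IH2.
rewrite !signed_hom_cat !act_cat; congr (act _ _).
have := reduced_act (signed_hom q) red_st; set st' := act _ _ => red_st'.
case: lr => [l' r' lr|a e]; first by rewrite !signed_hom_positive (h_rel lr).
by case: e; rewrite /signed_hom /= cats0 act_cat /signed /= ?act_invl ?act_invr.
Qed.

(** A homomorphism from a presented group to a free group preserves conjugacy.
    It is given by the images [h] of the generators, and respects the relations
    in the sense of the action on reduced words. *)
Lemma conj_free_conj (U V : seq (A * bool)) :
  (exists g : presented_group R,
     (class_of (group_relation R) U : presented_group R) ^ g
       = class_of (group_relation R) V) ->
  free_conj (signed_hom U) (signed_hom V).
Proof.
case=> g E; have [w Ew] := class_of_surj g.
have E2 : congruent (group_relation R) (w ++ V) (U ++ w).
  apply/class_ofP; rewrite !class_ofM -Ew.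
  suff H : g * (class_of (group_relation R) V : presented_group R)
     = class_of (group_relation R) U * g by exact: H.
  exact: conjg_eq_mulr E.
have E3 : congruent (group_relation R) V (inv_word w ++ U ++ w).
  apply: (@congruent_trans _ _ _ (inv_word w ++ w ++ V)).
    rewrite catA -{1}[V]cat0s; apply: congruent_cat (congruent_refl _ _).
    by rewrite -{2}[w]inv_wordK; apply/congruent_sym/congruent_inv_wordr.
  exact: congruent_cat (congruent_refl _ _) E2.
set W := signed_hom w.
apply: (free_conj_trans (y := inv_word W ++ signed_hom U ++ W)).
  by have [i [j Eij]] := free_conj_conj (signed_hom U) W; exists j, i.
apply: eq_free_conj; rewrite /freduce -signed_hom_inv -!signed_hom_cat.
exact/esym/(act_congruent E3).
Qed.

End SignedWords.

Section Gmn.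
Local Open Scope group_scope.
Variables m n : nat.
Notation gen := (gen m n).
Notation s := (gen_s m n).
Notation side := (@side m n).
Notation Gg := (Gmn_group m n).
Notation Rel := (@Gmn_relation m n).

(** The projection of the group to the infinite cyclic group of Delta, counting
    s; this group is regarded as free on one letter. *)
Definition central_word (x : gen) : seq (gen * bool) :=
  if x == s then [:: (s, false)] else [::].

(** The projection to the free group on one side; s goes to the inverse of the
    product of the letters of that side, since the cycle goes to 1. *)
Definition side_word c (x : gen) : seq (gen * bool) :=
  if x == s then inv_word (positive_word (side c))
  else if on c x then [:: (x, false)] else [::].

Lemma side_word_proj c l :
  flatten (map (side_word c) l) = flatten (map (side_word c) (proj c l)).
Proof.
elim: l => //= x l ->; case: ifP => //= onx.
rewrite {1}/side_word onx; case: eqP onx => [-> //|//].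
Qed.

Lemma side_word_side c : flatten (map (side_word c) (side c)) = positive_word (side c).
Proof.
have H l : all (fun x => (x != s) && on c x) l ->
    flatten (map (side_word c) l) = positive_word l.
  elim: l => //= x l IH /andP[/andP[xs onx] /IH->].
  by rewrite /side_word (negPf xs) onx.
exact/H/all_side.
Qed.

(** If [x y] acts trivially, so does its conjugate [y x]. *)
Lemma act_rot_id (A : choiceType) (x y st : seq (A * bool)) :
  (forall st, reduced st -> act (x ++ y) st = st) -> reduced st ->
  act (y ++ x) st = st.
Proof.
move=> H red_st; have := H _ (reduced_act x red_st).
rewrite !act_cat => /(congr1 (act (inv_word x))).
by rewrite !act_invl // ?reduced_act.
Qed.

Lemma side_word_relation c l r : Rel l r -> forall st, reduced st ->
  act (flatten (map (side_word c) l)) st = act (flatten (map (side_word c) r)) st.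
Proof.
case/(relation_cases c) => [E|[k [-> ->]]] st red_st.
  by rewrite side_word_proj E -side_word_proj.
have Hid z : reduced z -> act (flatten (map (side_word c) (cyc m n c))) z = z.
  by move=> red_z; rewrite /= -/(side c) side_word_side act_cat {1}/side_word /= act_invl.
rewrite Hid // map_rot /rot flatten_cat act_rot_id // => z red_z.
by rewrite -flatten_cat cat_take_drop Hid.
Qed.

Lemma central_word_relation l r : Rel l r -> forall st, reduced st ->
  act (flatten (map central_word l)) st = act (flatten (map central_word r)) st.
Proof.
have H w : flatten (map central_word w) = nseq (count_mem s w) (s, false).
  by elim: w => //= x w ->; rewrite /central_word; case: eqP.
suff HR : Rel l r -> perm_eq l r by move=> /HR/permP lr st _; rewrite !H lr.
by case=> [{}l {}r [k]|{}l {}r [k]|i j {}l {}r [k]]; rewrite perm_sym perm_rot.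
Qed.

Definition group_class (x : seq (gen * bool)) : Gg := class_of (group_relation Rel) x.

Lemma group_class_cat x y : group_class (x ++ y) = group_class x * group_class y.
Proof. exact: class_ofM. Qed.

Lemma group_class_inv x : group_class (inv_word x) = (group_class x)^-1.
Proof.
apply/eqP; rewrite -(can_eq (mulKg (group_class x))) mulgV -group_class_cat; apply/eqP.
exact/class_ofP/congruent_inv_wordr.
Qed.

Definition letter (x : gen) : Gg := group_class [:: (x, false)].

Lemma eval_group_class w : eval letter w = group_class w.
Proof.
elim: w => [|a w IH]; first by rewrite eval_nil.
rewrite eval_cons IH -[a :: w]cat1s group_class_cat; congr (_ * _).
by case: a => a [] //; rewrite /eval_letter /letter /= -group_class_inv.
Qed.

Definition centre : Gg := group_class (positive_word ((s :: word_t m n) ++ word_u m n)).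

(** Sending the letters of the other side, and s, to 1 makes all values of the
    two evaluations commute, whatever words are evaluated. *)
Definition side_letter c (x : gen) : Gg := if (x != s) && on c x then letter x else 1.

Lemma group_class_commute x y : congruent Rel (x ++ y) (y ++ x) ->
  commute (group_class (positive_word x)) (group_class (positive_word y)).
Proof.
move=> /cong_positive; rewrite !positive_cat => /class_ofP.
by rewrite /commute -!group_class_cat.
Qed.

Lemma centre_central (g : Gg) : commute centre g.
Proof.
have [w ->] := class_of_surj g; rewrite -/(group_class w) -eval_group_class.
apply: commute_eval => x; apply: (@group_class_commute _ [:: x]).
have := Delta_central (class_of Rel [:: x]); rewrite -!class_ofM.
by move/class_ofP.
Qed.

Lemma side_letter_commute x y : commute (side_letter true x) (side_letter false y).
Proof.
rewrite /side_letter; case: ifP => [/andP[xs onx]|_]; last exact/commute_sym/commute1.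
case: ifP => [/andP[ys ony]|_]; last exact: commute1.
apply: (@group_class_commute [:: x] [:: y]); apply/congruent_sym.
exact: (@cong_comm m n true x y).
Qed.

Definition central_part w : Gg := eval (fun _ => centre) (signed_hom central_word w).
Definition side_part c w : Gg := eval (side_letter c) (signed_hom (side_word c) w).

Lemma eval_central w (g : Gg) : commute (eval (fun _ : gen => centre) w) g.
Proof. by apply/commute_sym/commute_eval => _; apply/commute_sym/centre_central. Qed.

Lemma eval_side_letter_commute x y :
  commute (eval (side_letter true) x) (eval (side_letter false) y).
Proof.
apply: commute_eval => b; apply/commute_sym/commute_eval => a.
exact/commute_sym/side_letter_commute.
Qed.

Lemma eval_side_letter_side c :
  eval (side_letter c) (positive_word (side c)) =
  group_class (positive_word (side c)).
Proof.
rewrite -eval_group_class /positive_word; set l := side c.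
have : all (fun x => (x != s) && on c x) l by apply: all_side.
elim: l => [|x l IH] /=; first by rewrite !eval_nil.
case/andP=> xon /IH E.
by rewrite !eval_cons E /eval_letter /= /side_letter xon.
Qed.

(** For s this is [s = Delta T^-1 U^-1]. *)
Lemma letter_decomp x :
  letter x = eval (fun _ => centre) (central_word x)
    * eval (side_letter true) (side_word true x)
    * eval (side_letter false) (side_word false x).
Proof.
rewrite /central_word /side_word; case: (eqVneq x s) => [->|xs].
  rewrite !eval_inv !eval_side_letter_side eval_cons eval_nil mulg1 /eval_letter /=.
  have -> : centre = letter s * group_class (positive_word (word_t m n))
      * group_class (positive_word (word_u m n)).
    by rewrite /centre /letter -!group_class_cat positive_cat.
  have E : commute (group_class (positive_word (word_t m n)))
      (group_class (positive_word (word_u m n))).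
    rewrite -[word_t m n]/(side true) -[word_u m n]/(side false) -!eval_side_letter_side.
    exact: eval_side_letter_commute.
  by rewrite -(mulgA (letter s)) E !mulgA !mulgK.
case: x xs => [[i|j]|] //= _; rewrite !eval_cons !eval_nil ?mulg1 ?mul1g //.
Qed.

Lemma word_decomp w :
  group_class w = central_part w * side_part true w * side_part false w.
Proof.
rewrite -eval_group_class; elim: w => [|a w IH].
  by rewrite /central_part /side_part /= !eval_nil !mulg1.
rewrite eval_cons IH -cat1s /central_part /side_part.
rewrite !signed_hom_cat !eval_cat !eval_nil !mulg1.
have HZ := eval_central; have HB := eval_side_letter_commute.
set z := eval _ (signed_hom central_word w); set t := eval _ (signed_hom _ w).
set u := eval (side_letter false) (signed_hom _ w).
set z' := eval _ (signed central_word a); set t' := eval (side_letter true) (signed _ a).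
set u' := eval (side_letter false) (signed _ a).
have -> : eval_letter letter a = z' * t' * u'.
  rewrite /z' /t' /u'; case: (a) => x []; rewrite /signed /= /eval_letter /=.
    rewrite !eval_inv letter_decomp !invgM.
    set p := eval _ (central_word x); set q := eval _ (side_word true x).
    set r := eval _ (side_word false x).
    have Hp g : commute p^-1 g by apply/commute_sym/commuteV/commute_sym/HZ.
    have Hq : commute q^-1 r^-1 by apply/commuteV/commute_sym/commuteV/commute_sym/HB.
    by rewrite mulgA -Hq -(Hp _) mulgA.
  exact: letter_decomp.
have Hz g : z * g = g * z by apply: HZ.
have Ht : t * u' = u' * t by apply: HB.
rewrite -!mulgA; congr (_ * _).
by rewrite !mulgA -[t' * u' * z]Hz !mulgA -(mulgA _ u' t) -Ht !mulgA.
Qed.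

Lemma commute_conjg (G : groupType) (x y : G) : commute x y -> x ^ y = x.
Proof. by rewrite conjgE => ->; rewrite mulKg. Qed.

(** Conjugators of the two side components commute with the component of the
    other side, and the central component is invariant; so the product of the
    two conjugators conjugates the whole. *)
Lemma group_conjP (U V : seq (gen * bool)) :
  (exists g : Gg, group_class U ^ g = group_class V) <->
  [/\ free_conj (signed_hom central_word U) (signed_hom central_word V),
      free_conj (signed_hom (side_word true) U) (signed_hom (side_word true) V)
    & free_conj (signed_hom (side_word false) U) (signed_hom (side_word false) V)].
Proof.
split=> [UV|[]].
  split; [exact: (conj_free_conj central_word_relation) | |];
    exact: (conj_free_conj (@side_word_relation _)).
move=> /(eval_free_conj (fun _ => centre))[z0 E0].
move=> /(eval_free_conj (side_letter true))[zt Et].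
move=> /(eval_free_conj (side_letter false))[zu Eu].
exists (eval (side_letter true) zt * eval (side_letter false) zu).
rewrite !word_decomp /central_part /side_part !conjMg !(conjgM _ (eval _ zt)) Et.
rewrite (commute_conjg (eval_central _ _)) in E0.
rewrite -{}E0 !(commute_conjg (eval_central _ _)).
rewrite (commute_conjg (eval_side_letter_commute _ _)).
by rewrite (commute_conjg (commute_sym (eval_side_letter_commute _ _))) Eu.
Qed.

Theorem group_conj_decidable : group_conjugacy_solvable (@Gmn_relation m n).
Proof.
have sim h := sim_free_conjb (signed (A := gen) (B := gen) h).
apply: decidable_simulated (sim_andb (sim central_word)
  (sim_andb (sim (side_word true)) (sim (side_word false)))) _.
move=> U V; split=> [/group_conjP[H1 H2 H3]|].
  by apply/and3P; split; apply/free_conjP.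
by case/and3P=> H1 H2 H3; apply/group_conjP; split; apply/free_conjP.
Qed.

Theorem monoid_conj_decidable : monoid_conjugacy_solvable (@Gmn_relation m n).
Proof.
have sim h := sim_free_conjb (A := gen) (B := gen) h.
apply: decidable_simulated (sim_andb (sim central_word)
  (sim_andb (sim (side_word true)) (sim (side_word false)))) _.
move=> U V; rewrite monoid_conj_group; split=> [/group_conjP|].
  rewrite !signed_hom_positive => -[H1 H2 H3].
  by apply/and3P; split; apply/free_conjP.
case/and3P=> H1 H2 H3; apply/group_conjP; rewrite !signed_hom_positive.
by split; apply/free_conjP.
Qed.

End Gmn.

Theorem mainTheorem1 (m n : nat) (hm : 2 <= m) (hn : 2 <= n) :
  (forall w : Gmn_monoid m n, property_P w (Delta m n)) /\
  monoid_conjugacy_solvable (@Gmn_relation m n) /\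
  group_conjugacy_solvable (@Gmn_relation m n).
Proof.
split; first exact: property_P_Delta.
by split; [apply: monoid_conj_decidable | apply: group_conj_decidable].
Qed.
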